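(* Let $\Gamma$ be a $T$-lattice of directly split Nagao type with $T$ biregular, let $G=\mathrm{Aut}(T)$, let $L\leq G$ be the subgroup of level-preserving automorphisms and $G^\circ\leq G$ the subgroup of type-preserving automorphisms. If the commensurator $C(\Gamma)$ of $\Gamma$ in $G$ is not contained in $L$, then the closure of $C(\Gamma)$ in $G$ contains $G^\circ$.
   Context: Lattices of Nagao type. Let $R$ be an infinite ray with vertices $x_0,x_1,x_2,\dots$. To each vertex $x_i$ ($i\geq 0$) a finite group $\Gamma_i$ is attached such that $\Gamma_i\leq\Gamma_{i+1}$ for all $i>0$, and a common subgroup $H_0$ of $\Gamma_0$ and $\Gamma_1$ is given. Put $k=[\Gamma_0:H_0]$, $q_0=k-1$, $q_1=[\Gamma_1:H_0]$, $q_i=[\Gamma_i:\Gamma_{i-1}]$ for $i\geq 2$; it is required that $q_i\geq 2$ for all $i\geq 0$. Attach $H_0$ to the edge $\{x_0,x_1\}$ and $\Gamma_i$ to the edge $\{x_i,x_{i+1}\}$ for $i>0$ (with the inclusion maps); this is a graph of groups on $R$. Let $\Gamma$ be its fundamental group and $T$ its Bass–Serre tree, on which $\Gamma$ acts with $R$ as fundamental domain, with $\Gamma_i=\mathrm{Stab}_\Gamma(x_i)$ and $H_0=\mathrm{Stab}_\Gamma(\{x_0,x_1\})$. Let $G=\mathrm{Aut}(T)$, with the topology in which the pointwise fixators of finite subtrees form a basis of open neighborhoods of the identity. The image of $\Gamma$ in $G$ (the kernel is a finite subgroup of $H_0$) is again denoted by $\Gamma$; it is a non-uniform lattice in $G$,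 called a ($T$-)lattice of Nagao type. Directly split. $\Gamma$ is of directly split Nagao type if there exist, for all $j>0$, $H_0$-invariant (i.e. normalized by $H_0$) subgroups $U_j\leq\Gamma_j$ such that $\Gamma_i=H_0\ltimes(U_1\times U_2\times\cdots\times U_i)$ (internal products) for all $i>0$. Level. Each vertex $x$ of $T$ lies in the orbit $\Gamma.x_i$ for exactly one $i\geq0$; this $i$ is the level $\ell(x)$. Put $L=\{g\in G\mid \ell(g.x)=\ell(x)\text{ for all vertices }x\text{ of }T\}$. Commensurator. $C(\Gamma)=\{g\in G\mid \Gamma\cap g\Gamma g^{-1}\text{ has finite index in }\Gamma\text{ and in }g\Gamma g^{-1}\}$. Types. Two vertices of $T$ have the same type if they are at even distance from each other; $T$ is biregular if any two vertices of the same type have the same degree. $G^\circ$ is the subgroup (of index at most 2) of $G$ of all type-preserving automorphisms, i.e. those preserving the 2-colouring of $T$. *)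

(* Defs.v *)
From HB Require Import structures.
From mathcomp Require Import all_boot all_fingroup.
From mathcomp Require Import generic_quotient.
From mathcomp Require Import boolp classical_sets functions cardinality.
From mathcomp Require Import filter topology.

Set Implicit Arguments.
Unset Strict Implicit.
Unset Printing Implicit Defensive.

Import GroupScope.

(* A graph of finite groups on the ray x_0, x_1, x_2, ... .  The chain
   Gamma_1 <= Gamma_2 <= ... is a direct system of injective morphisms
   [inc i j] for 0 < i <= j; the values of [inc] at other indices are
   irrelevant and never used.  [h0] and [h1] embed the common subgroup H_0
   in Gamma_0 and Gamma_1. *)
Record nagao_ray := NagaoRay {
  vgrp : nat -> finGroupType;
  egrp0 : finGroupType;
  h0 : {morphism [set: egrp0] >-> vgrp 0};
  h1 : {morphism [set: egrp0] >-> vgrp 1};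
  inc : forall i j : nat, vgrp i -> vgrp j;
  h0_inj : injective h0;
  h1_inj : injective h1;
  inc_morph : forall i j, 0 < i <= j -> {morph @inc i j : x y / x * y};
  inc_inj : forall i j, 0 < i <= j -> injective (@inc i j);
  inc_id : forall i, 0 < i -> @inc i i =1 id;
  inc_comp : forall i j k, 0 < i <= j -> j <= k ->
    @inc j k \o @inc i j =1 @inc i k
}.

Section NagaoType.
Variable N : nagao_ray.

Definition nagao_q (i : nat) : nat :=
  match i with
  | 0 => #|[set: vgrp N 0] : h0 N @: [set: egrp0 N]|.-1
  | 1 => #|[set: vgrp N 1] : h1 N @: [set: egrp0 N]|
  | (j.+1 as i').+1 => #|[set: vgrp N i'.+1] : @inc N i' i'.+1 @: [set: vgrp N i']|
  end.

Definition nagao_type : Prop := forall i, 1 < nagao_q i.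

(* The copy of H_0 in Gamma_i, for i > 0. *)
Definition egrp0_in (i : nat) : {set vgrp N i} :=
  @inc N 1 i @: (h1 N @: [set: egrp0 N]).

(* In [K ><| H] the normal factor is on the left, and [dprod] is the internal
   direct product: both are [set0] when the product is not of that kind. *)
Definition directly_split : Prop :=
  exists U : forall j, {group vgrp N j},
    (forall j, 0 < j -> egrp0_in j \subset 'N(U j)) /\
    (forall i, 0 < i ->
       (\big[dprod/1]_(1 <= j < i.+1) (@inc N j i @: U j)) ><| egrp0_in i
         = [set: vgrp N i]).

End NagaoType.

(* As the underlying graph is a tree, the fundamental group is the amalgam of
   the vertex groups along the edge groups (H_0 for {x_0, x_1} and Gamma_i for
   {x_i, x_i+1}, i > 0): words in the disjoint union of the vertex groups
   modulo the congruence generated by the relations of the vertex groups and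
   the identifications along the edges. *)

Section FundamentalGroup.
Variable N : nagao_ray.

Definition letter := {i : nat & vgrp N i}.
Definition word := seq letter.
Definition lett (i : nat) (x : vgrp N i) : letter := Tagged (vgrp N) x.

Inductive word_eq : word -> word -> Prop :=
| word_eq_refl u : word_eq u u
| word_eq_sym u v : word_eq u v -> word_eq v u
| word_eq_trans v u w : word_eq u v -> word_eq v w -> word_eq u w
| word_eq_cat u u' v v' :
    word_eq u u' -> word_eq v v' -> word_eq (u ++ v) (u' ++ v')
| word_eq_one i : word_eq [:: @lett i 1] [::]
| word_eq_mul i (x y : vgrp N i) :
    word_eq [:: lett x; lett y] [:: lett (x * y)]
| word_eq_edge0 (h : egrp0 N) : word_eq [:: lett (h0 N h)] [:: lett (h1 N h)]
| word_eq_edge i (x : vgrp N i) : 0 < i ->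
    word_eq [:: lett x] [:: lett (@inc N i i.+1 x)].

Definition word_eqb : rel word := fun u v => `[< word_eq u v >].

Lemma word_eqb_equiv : equiv_class_of word_eqb.
Proof.
split=> [u|u v|v u w]; first exact/asboolP/word_eq_refl.
- by apply/asboolP/asboolP; exact: word_eq_sym.
- by move=> /asboolP uv /asboolP vw; apply/asboolP; exact: word_eq_trans vw.
Qed.

Canonical word_equiv := EquivRelPack word_eqb_equiv.

Definition pi1 := {eq_quot word_equiv}%qT.
HB.instance Definition _ := Choice.on pi1.

Definition pi1_of (u : word) : pi1 := \pi_{eq_quot word_equiv}%qT u.

Lemma pi1_ofP u v : pi1_of u = pi1_of v <-> word_eq u v.
Proof.
by split=> [/eqmodP /asboolP //|uv]; apply/eqmodP/asboolP.
Qed.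

Lemma pi1_reprK (x : pi1) : pi1_of (repr x) = x.
Proof. exact: reprK. Qed.

Lemma pi1_repr u : word_eq (repr (pi1_of u)) u.
Proof. by apply/pi1_ofP; rewrite pi1_reprK. Qed.

Lemma pi1_ind (P : pi1 -> Prop) : (forall u, P (pi1_of u)) -> forall x, P x.
Proof. by move=> H x; rewrite -[x]pi1_reprK. Qed.

Definition letter_inv (a : letter) : letter := lett (tagged a)^-1.
Definition word_inv (u : word) : word := rev (map letter_inv u).

Lemma word_inv_l u : word_eq (word_inv u ++ u) [::].
Proof.
elim: u => [|[i x] u IH]; first exact: word_eq_refl.
rewrite /word_inv /= rev_cons cat_rcons.
apply: word_eq_trans IH; apply: word_eq_cat; first exact: word_eq_refl.
rewrite -[_ :: _ :: u]/([:: lett x^-1; lett x] ++ u) -{2}[u]cat0s.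
apply: word_eq_cat (word_eq_refl u).
by apply: word_eq_trans (word_eq_mul _ _) _; rewrite mulVg; exact: word_eq_one.
Qed.

Lemma word_inv_r u : word_eq (u ++ word_inv u) [::].
Proof.
have invK : word_inv (word_inv u) = u.
  rewrite /word_inv map_rev revK -map_comp; elim: u => //= -[i x] u ->.
  by rewrite /letter_inv /= invgK.
by rewrite -{1}invK; exact: word_inv_l.
Qed.

Lemma word_inv_eq u v : word_eq u v -> word_eq (word_inv u) (word_inv v).
Proof.
move=> uv; apply: (@word_eq_trans (word_inv u ++ v ++ word_inv v)).
  rewrite -{1}[word_inv u]cats0; apply: word_eq_cat; first exact: word_eq_refl.
  exact/word_eq_sym/word_inv_r.
rewrite catA -[X in word_eq _ X]cat0s; apply: word_eq_cat (word_eq_refl _).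
apply: word_eq_trans (word_inv_l u).
by apply: word_eq_cat; [exact: word_eq_refl | exact: word_eq_sym].
Qed.

Definition pi1_one : pi1 := pi1_of [::].
Definition pi1_mul (x y : pi1) : pi1 := pi1_of (repr x ++ repr y).
Definition pi1_inv (x : pi1) : pi1 := pi1_of (word_inv (repr x)).

Lemma pi1_mulE u v : pi1_mul (pi1_of u) (pi1_of v) = pi1_of (u ++ v).
Proof. by apply/pi1_ofP/word_eq_cat; exact: pi1_repr. Qed.

Lemma pi1_invE u : pi1_inv (pi1_of u) = pi1_of (word_inv u).
Proof. by apply/pi1_ofP/word_inv_eq/pi1_repr. Qed.

Lemma pi1_mulA : associative pi1_mul.
Proof.
elim/pi1_ind=> u; elim/pi1_ind=> v; elim/pi1_ind=> w.
by rewrite !pi1_mulE catA.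
Qed.

Lemma pi1_mul1 : left_id pi1_one pi1_mul.
Proof. by elim/pi1_ind=> u; rewrite pi1_mulE. Qed.

Lemma pi1_1mul : right_id pi1_one pi1_mul.
Proof. by elim/pi1_ind=> u; rewrite pi1_mulE cats0. Qed.

Lemma pi1_mulV : left_inverse pi1_one pi1_inv pi1_mul.
Proof.
by elim/pi1_ind=> u; rewrite pi1_invE pi1_mulE; exact/pi1_ofP/word_inv_l.
Qed.

Lemma pi1_Vmul : right_inverse pi1_one pi1_inv pi1_mul.
Proof.
by elim/pi1_ind=> u; rewrite pi1_invE pi1_mulE; exact/pi1_ofP/word_inv_r.
Qed.

HB.instance Definition _ := isGroup.Build pi1
  pi1_mulA pi1_mul1 pi1_1mul pi1_mulV pi1_Vmul.

Definition vemb (i : nat) (x : vgrp N i) : pi1 := pi1_of [:: lett x].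

End FundamentalGroup.


Local Open Scope classical_set_scope.

Definition gcoset (G : groupType) (g : G) (A : set G) : set G :=
  [set g * h | h in A].

Section BassSerreTree.
Variable N : nagao_ray.

Definition vstab (i : nat) : set (pi1 N) := range (@vemb N i).

Record vertex := Vertex {
  level : nat;
  vcoset : set (pi1 N);
  vcosetP : exists g, vcoset = gcoset g (vstab level)
}.

HB.instance Definition _ := gen_eqMixin vertex.
HB.instance Definition _ := gen_choiceMixin vertex.

Lemma vertexP (v w : vertex) :
  level v = level w -> vcoset v = vcoset w -> v = w.
Proof.
case: v w => [i A p] [j B q] /= ij AB; case: _ / ij q => q.
by case: _ / AB q => q; congr Vertex; exact: Prop_irrelevance.
Qed.

Definition bvertex (g : pi1 N) (i : nat) : vertex :=
  Vertex (ex_intro _ g (erefl (gcoset g (vstab i)))).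

Lemma vact_proof (g : pi1 N) (v : vertex) :
  exists h, gcoset g (vcoset v) = gcoset h (vstab (level v)).
Proof.
have [h ->] := vcosetP v; exists (g * h).
apply/seteqP; split=> [_ [_ [x xA <-] <-]|_ [x xA <-]].
  by exists x => //; rewrite mulgA.
by exists (h * x); [exists x | rewrite mulgA].
Qed.

Definition vact (g : pi1 N) (v : vertex) : vertex := Vertex (vact_proof g v).

Lemma vact_bvertex g h i : vact g (bvertex h i) = bvertex (g * h) i.
Proof.
apply: vertexP => //=; apply/seteqP; split=> [_ [_ [x xA <-] <-]|_ [x xA <-]].
  by exists x => //; rewrite mulgA.
by exists (h * x); [exists x | rewrite mulgA].
Qed.

Lemma bvertexE v : exists g, v = bvertex g (level v).
Proof. by have [g gE] := vcosetP v; exists g; exact: vertexP. Qed.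

Lemma level_orbit (v : vertex) (i : nat) :
  level v = i <-> exists g, v = vact g (bvertex 1 i).
Proof.
split=> [<-|[g ->] //]; have [g ->] := bvertexE v.
by exists g; rewrite vact_bvertex mulg1.
Qed.

(* The edges are the translates of the edges {x_i, x_i+1} of the ray.  Since a
   tree has no multiple edges, the edge relation on vertices determines it. *)
Definition adj : rel vertex := fun v w =>
  `[< exists g i, (v = bvertex g i /\ w = bvertex g i.+1) \/
                  (w = bvertex g i /\ v = bvertex g i.+1) >].

Definition is_dist (v w : vertex) (n : nat) : Prop :=
  (exists p, [/\ path adj v p, last v p = w & size p = n]) /\
  (forall p, path adj v p -> last v p = w -> n <= size p).

Definition same_type (v w : vertex) : Prop :=
  exists2 n, is_dist v w n & ~~ odd n.

(* The degree of v is the cardinality of its set of neighbours. *)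
Definition biregular : Prop := forall v w, same_type v w ->
  ([set u | adj v u] #= [set u | adj w u])%card.

Definition finite_subtree (F : set vertex) : Prop :=
  [/\ finite_set F, F !=set0 &
    forall v w, F v -> F w ->
      exists p, [/\ path adj v p, last v p = w & {in p, forall u, F u}]].

Lemma vact1 v : vact 1 v = v.
Proof. by have [g ->] := bvertexE v; rewrite vact_bvertex mul1g. Qed.

Lemma vactM g h v : vact (g * h) v = vact g (vact h v).
Proof. by have [k ->] := bvertexE v; rewrite !vact_bvertex mulgA. Qed.

Lemma vactK g : cancel (vact g) (vact g^-1).
Proof. by move=> v; rewrite -vactM mulVg vact1. Qed.

Lemma vactVK g : cancel (vact g^-1) (vact g).
Proof. by move=> v; rewrite -vactM mulgV vact1. Qed.

Lemma vact_adj_sub g v w : adj v w -> adj (vact g v) (vact g w).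
Proof.
move=> /asboolP[h [i [[-> ->]|[-> ->]]]]; apply/asboolP; exists (g * h), i;
  rewrite !vact_bvertex; by [left | right].
Qed.

Lemma vact_adj g v w : adj (vact g v) (vact g w) = adj v w.
Proof.
apply/idP/idP; last exact: vact_adj_sub.
by move/(@vact_adj_sub g^-1); rewrite !vactK.
Qed.

Lemma adj_sym v w : adj v w -> adj w v.
Proof.
by move=> /asboolP[g [i H]]; apply/asboolP; exists g, i; case: H; [right|left].
Qed.

Definition connected_to (v w : vertex) : Prop :=
  exists p, path adj v p /\ last v p = w.

Lemma connected_refl v : connected_to v v.
Proof. by exists [::]. Qed.

Lemma connected_trans w v u :
  connected_to v w -> connected_to w u -> connected_to v u.
Proof.
move=> [p [vp pw]] [q [wq qu]]; exists (p ++ q).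
by rewrite cat_path last_cat vp pw.
Qed.

Lemma connected_adj v w : adj v w -> connected_to v w.
Proof. by move=> vw; exists [:: w]; rewrite /= vw. Qed.

Lemma connected_sym v w : connected_to v w -> connected_to w v.
Proof.
move=> [p [+ <-]]; elim: p v => [|u p IH] v /=; first by move=> _; exists [::].
move=> /andP[vu /IH pu]; apply: connected_trans pu _.
exact/connected_adj/adj_sym.
Qed.

Lemma connected_act g v w :
  connected_to v w -> connected_to (vact g v) (vact g w).
Proof.
move=> [p [+ <-]]; elim: p v => [|u p IH] v /=; first by move=> _; exists [::].
move=> /andP[vu /IH]; apply: connected_trans.
by apply: connected_adj; rewrite vact_adj.
Qed.

Lemma vact_stab i (x : vgrp N i) : vact (vemb x) (bvertex 1 i) = bvertex 1 i.
Proof.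
rewrite vact_bvertex; apply: vertexP => //=; rewrite mulg1.
have vembM (a b : vgrp N i) : vemb a * vemb b = vemb (a * b).
  by rewrite [LHS]pi1_mulE; exact/pi1_ofP/word_eq_mul.
apply/seteqP; split=> _ [_ [y _ <-] <-].
  by exists (vemb (x * y)); [exists (x * y) | rewrite mul1g vembM].
exists (vemb (x^-1 * y)); first by exists (x^-1 * y).
by rewrite vembM mulgA mulgV !mul1g.
Qed.

Lemma connected_ray i : connected_to (bvertex 1 0) (bvertex 1 i).
Proof.
elim: i => [|i IH]; first exact: connected_refl.
by apply: connected_trans IH _; apply/connected_adj/asboolP; exists 1, i; left.
Qed.

Lemma tree_connected v w : connected_to v w.
Proof.
suff conn0 u : connected_to (bvertex 1 0) u.
  by apply: connected_trans (conn0 w); exact/connected_sym/conn0.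
have [g ->] := bvertexE u; rewrite -[g]mulg1 -vact_bvertex.
move: (level u) => k {u}; elim/pi1_ind: g => u.
elim: u => [|[i x] u IH].
  by rewrite -[pi1_of _]/(1 : pi1 N) vact1; exact: connected_ray.
have -> : pi1_of (lett x :: u) = vemb x * pi1_of u.
  by rewrite [RHS]pi1_mulE.
rewrite vactM; apply: connected_trans (connected_ray i) _.
rewrite -{1}(vact_stab x); apply: connected_act.
exact: connected_trans (connected_sym (connected_ray i)) IH.
Qed.

Lemma finite_subtree1 v : finite_subtree [set v].
Proof.
split; [exact: finite_set1 | by exists v | move=> _ _ -> ->].
by exists [::]; split.
Qed.

Lemma subtree_rev (F : set vertex) v p : path adj v p -> F v ->
  {in p, forall u, F u} ->
  exists q, [/\ path adj (last v p) q, last (last v p) q = v &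
    {in q, forall u, F u}].
Proof.
elim: p v => [|w p IH] v /=; first by exists [::]; split.
move=> /andP[vw wp] Fv Fp.
have Fw : F w by apply: Fp; rewrite inE eqxx.
have [|q [q1 q2 q3]] := IH w wp Fw.
  by move=> u up; apply: Fp; rewrite inE up orbT.
exists (rcons q v); split; rewrite ?rcons_path ?last_rcons ?q1 ?q2 //=.
  exact: adj_sym.
by move=> u; rewrite mem_rcons inE => /predU1P[->|/q3].
Qed.

Lemma finite_subtreeU (F1 F2 : set vertex) :
  finite_subtree F1 -> finite_subtree F2 ->
  exists F, [/\ finite_subtree F, F1 `<=` F & F2 `<=` F].
Proof.
move=> [fin1 [v1 Fv1] con1] [fin2 [v2 Fv2] con2].
have [p [v1p pv2]] := tree_connected v1 v2.
pose F := F1 `|` F2 `|` [set` p]; exists F; split; last 2 first.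
- by move=> x; do 2 left.
- by move=> x; left; right.
have to_v1 v : F v -> exists q,
    [/\ path adj v1 q, last v1 q = v & {in q, forall u, F u}].
  case=> [[Fv|Fv]|/= vp].
  - have [q [q1 q2 q3]] := con1 _ _ Fv1 Fv; exists q; split=> // u /q3.
    by left; left.
  - have [q [q1 q2 q3]] := con2 _ _ Fv2 Fv; exists (p ++ q).
    rewrite cat_path last_cat pv2 v1p q1 q2; split=> // u.
    by rewrite mem_cat => /orP[|/q3]; [right | left; right].
  - have [p1 [p2 pE]] : exists p1 p2, p = rcons p1 v ++ p2.
      by case/path.splitP: vp => p1 p2; exists p1, p2.
    exists (rcons p1 v); move: v1p; rewrite pE cat_path last_rcons => /andP[-> _].
    by split=> // u up; right; rewrite /= pE mem_cat up.
split; first by rewrite !finite_setU; split; [split | exact: finite_seq].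
  by exists v1; left; left.
move=> v w Fv Fw; have [q [q1 q2 q3]] := to_v1 _ Fv.
have [|r [r1 r2 r3]] := subtree_rev q1 _ q3; first by left; left.
have [t [t1 t2 t3]] := to_v1 _ Fw; rewrite q2 in r1 r2.
exists (r ++ t); rewrite cat_path last_cat r2 r1; split=> // u.
by rewrite mem_cat => /orP[/r3|/t3].
Qed.

End BassSerreTree.

Section AutomorphismGroup.
Variable N : nagao_ray.
Local Notation V := (vertex N).

Record tree_aut := Aut {
  aut_fun :> V -> V;
  aut_bij : bijective aut_fun;
  aut_adj : forall v w, adj (aut_fun v) (aut_fun w) = adj v w
}.

HB.instance Definition _ := gen_eqMixin tree_aut.
HB.instance Definition _ := gen_choiceMixin tree_aut.

Lemma autP (f g : tree_aut) : f =1 g -> f = g.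
Proof.
case: f g => [f fb fa] [g gb ga] /= /funext fg.
by case: _ / fg gb ga => gb ga; congr Aut; exact: Prop_irrelevance.
Qed.

Definition aut_one : tree_aut :=
  Aut (Bijective (fun=> erefl) (fun=> erefl)) (fun v w => erefl (adj v w)).

Lemma aut_mul_adj (f g : tree_aut) v w : adj ((f \o g) v) ((f \o g) w) = adj v w.
Proof. by rewrite /= !aut_adj. Qed.

Definition aut_mul (f g : tree_aut) : tree_aut :=
  Aut (bij_comp (aut_bij f) (aut_bij g)) (aut_mul_adj f g).

Lemma aut_inv_ex (f : tree_aut) : exists g : tree_aut, cancel f g /\ cancel g f.
Proof.
have [g fK gK] := aut_bij f.
have ga v w : adj (g v) (g w) = adj v w by rewrite -(aut_adj f) !gK.
by exists (Aut (Bijective gK fK) ga).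
Qed.

Definition aut_inv (f : tree_aut) : tree_aut := projT1 (cid (aut_inv_ex f)).

Lemma aut_invK (f : tree_aut) : cancel f (aut_inv f).
Proof. by rewrite /aut_inv; case: cid => g []. Qed.

Lemma aut_invVK (f : tree_aut) : cancel (aut_inv f) f.
Proof. by rewrite /aut_inv; case: cid => g []. Qed.

Lemma aut_mulA : associative aut_mul. Proof. by move=> f g h; exact: autP. Qed.
Lemma aut_mul1 : left_id aut_one aut_mul. Proof. by move=> f; exact: autP. Qed.
Lemma aut_1mul : right_id aut_one aut_mul. Proof. by move=> f; exact: autP. Qed.
Lemma aut_mulV : left_inverse aut_one aut_inv aut_mul.
Proof. by move=> f; apply: autP => v /=; rewrite aut_invK. Qed.
Lemma aut_Vmul : right_inverse aut_one aut_inv aut_mul.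
Proof. by move=> f; apply: autP => v /=; rewrite aut_invVK. Qed.

HB.instance Definition _ := isGroup.Build tree_aut
  aut_mulA aut_mul1 aut_1mul aut_mulV aut_Vmul.

Lemma autM (f g : tree_aut) v : (f * g) v = f (g v). Proof. by []. Qed.

Definition fixator (F : set V) : set tree_aut := [set f | forall v, F v -> f v = v].

Lemma fixatorV (F : set V) (f : tree_aut) : fixator F f -> fixator F f^-1.
Proof. by move=> fF v Fv; rewrite -{1}(fF v Fv) -autM mulVg. Qed.

Lemma fixatorM (F : set V) (f g : tree_aut) :
  fixator F f -> fixator F g -> fixator F (f * g).
Proof. by move=> fF gF v Fv; rewrite autM gF // fF. Qed.

Definition aut_nbhs (g : tree_aut) : set_system tree_aut :=
  [set A | exists2 F, finite_subtree F & gcoset g (fixator F) `<=` A].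

HB.instance Definition _ := hasNbhs.Build tree_aut aut_nbhs.

Lemma aut_nbhs_filter (g : tree_aut) : ProperFilter (nbhs g).
Proof.
apply: Build_ProperFilter_ex => [A [F _ FA]|].
  by exists g; apply: FA; exists 1 => //; rewrite mulg1.
split=> [|A B [F Ft FA] [K Kt KB]|A B AB [F Ft FA]].
- by exists [set bvertex 1 0] => //; exact: finite_subtree1.
- have [E [Et FE KE]] := finite_subtreeU Ft Kt; exists E => // _ [h hE <-].
  split; [apply: FA | apply: KB]; exists h => // v Hv; apply: hE.
    exact: FE.
  exact: KE.
- by exists F => // h /FA /AB.
Qed.

Lemma aut_nbhs_singleton (g : tree_aut) (A : set tree_aut) : nbhs g A -> A g.
Proof. by move=> [F _]; apply; exists 1 => //; rewrite mulg1. Qed.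

Lemma aut_nbhs_nbhs (g : tree_aut) (A : set tree_aut) :
  nbhs g A -> nbhs g (nbhs^~ A).
Proof.
move=> [F Ft FA]; exists F => // _ [h hF <-]; exists F => // _ [k kF <-].
by apply: FA; exists (h * k); [exact: fixatorM | rewrite mulgA].
Qed.

HB.instance Definition _ := Nbhs_isNbhsTopological.Build tree_aut
  aut_nbhs_filter aut_nbhs_singleton aut_nbhs_nbhs.

Lemma aut_of_bij (g : pi1 N) : bijective (vact g).
Proof. by exists (vact g^-1); [exact: vactK | exact: vactVK]. Qed.

Definition aut_of (g : pi1 N) : tree_aut := Aut (aut_of_bij g) (vact_adj g).

(* The image of the fundamental group in Aut(T). *)
Definition nagao_lattice : set tree_aut := range aut_of.

Definition level_preserving : set tree_aut :=
  [set f | forall v, level (f v) = level v].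

Definition type_preserving : set tree_aut :=
  [set f | forall v, same_type (f v) v].

End AutomorphismGroup.

Arguments level_preserving : clear implicits.
Arguments type_preserving : clear implicits.
Arguments nagao_lattice : clear implicits.

(* [H] and [K] are meant to be subgroups with H <= K. *)
Definition finite_index (G : groupType) (H K : set G) : Prop :=
  finite_set [set gcoset k H | k in K].

Definition commensurator (G : groupType) (S : set G) : set G :=
  [set g | let gSg := [set g * s * g^-1 | s in S] in
    finite_index (S `&` gSg) S /\ finite_index (S `&` gSg) gSg].

(* Main.v *)
Require Import Defs.
From mathcomp Require Import all_boot all_fingroup.
From mathcomp Require Import boolp classical_sets functions cardinality.
From mathcomp Require Import filter topology.

(* Idea.  Write G_i for the vertex groups and G for the fundamental group.  The
   direct splitting gives compatible retractions of each G_j onto G_n (n < j)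
   and onto H_0, and these make G residually finite: if Y is a finite subset of G
   with Y G_0 = Y, let G_0 act on Y on the right, and let b in G_n act on y by
   right multiplication if y G_n lies in Y, and through the retraction onto H_0
   otherwise; the other G_j act through G_n.

   Let u, u' be neighbours of v on the same level.  Some element of the stabiliser
   of v exchanges them.  Performing this exchange at v and at all its translates
   under a deep finite index subgroup gives an element of the commensurator that
   exchanges u and u' and fixes any prescribed finite set of vertices joined to v
   by paths avoiding u and u'.  Such periodic exchanges are cocycles over a finite
   G-set.

   If some element c of the commensurator does not preserve levels, then at some
   vertex v it moves the unique upper neighbour to a lower one (or changes the
   level to or from 0), and conjugating by c gives exchanges of all pairs of
   neighbours of v.  This property spreads along the ray to all vertices, and then
   a type-preserving automorphism is approximated one vertex at a time. *)

Set Implicit Arguments.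
Unset Strict Implicit.
Unset Printing Implicit Defensive.

Import GroupScope.

(** * Retractions of the vertex groups *)

Section Retractions.

Lemma fun_morph1 (aT rT : groupType) (f : aT -> rT) :
  {morph f : x y / x * y} -> f 1 = 1.
Proof. by move=> fM; apply: (mulgI (f 1)); rewrite -fM !mulg1. Qed.

Lemma morph_imset_group_set (aT gT : finGroupType) (f : aT -> gT) (A : {group aT}) :
  {morph f : x y / x * y} -> group_set (f @: A).
Proof.
move=> fM; apply/group_setP; split=> [|x y /imsetP[a aA ->] /imsetP[b bA ->]].
  by apply/imsetP; exists 1; rewrite ?group1 // fun_morph1.
by rewrite -fM imset_f ?groupM.
Qed.

(** The projection onto the complement along the normal factor is a morphism; it is read back
    through [f]. *)
Lemma sdprod_retraction (aT gT : finGroupType) (f : aT -> gT) (K : {set gT}) :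
  injective f -> {morph f : x y / x * y} -> K ><| (f @: [set: aT]) = [set: gT] ->
  exists2 r : gT -> aT, {morph r : x y / x * y} & cancel f r.
Proof.
move=> f_inj fM KM; have [[G M defK defM] _ _ _] := sdprodP KM.
move: KM; rewrite {K}defK defM => KM.
have [nsKT _ KMT _ tiGM] := sdprod_context KM; have complM := sdprod_compl KM.
have remM x : exists a, f a == remgr G M x.
  have : remgr G M x \in M by rewrite mem_remgr // KMT inE.
  by rewrite -defM => /imsetP[a _ ->]; exists a.
exists (fun x => xchoose (remM x)) => [x y|a]; apply: f_inj.
  rewrite fM !(eqP (xchooseP (remM _))).
  by rewrite (remgrM complM nsKT) ?inE.
rewrite (eqP (xchooseP (remM _))) (remgr_id tiGM) // -defM.
exact: imset_f.
Qed.

Variable N : nagao_ray.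
Hypothesis hsplit : directly_split N.

Lemma inc_imset i j k (A : {set vgrp N i}) : 0 < i <= j -> j <= k ->
  @inc N j k @: (@inc N i j @: A) = @inc N i k @: A.
Proof.
by move=> ij jk; rewrite -imset_comp; apply: eq_imset; exact: inc_comp ij jk.
Qed.

Lemma retraction_egrp0 : exists2 r : vgrp N 1 -> egrp0 N,
  {morph r : x y / x * y} & cancel (h1 N) r.
Proof.
have [U [_ /(_ 1%N isT)]] := hsplit.
rewrite big_nat1 => UH; apply: sdprod_retraction (@h1_inj N) _ _.
  by move=> x y; rewrite morphM ?inE.
have id1 (A : {set vgrp N 1}) : @inc N 1 1 @: A = A.
  by rewrite -[RHS]imset_id; apply: eq_imset; exact: inc_id.
by move: UH; rewrite /egrp0_in !id1; exact.
Qed.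

(** Regroup the splitting as a semidirect product of U_(i+1) by G_i: U_(i+1) is normalised by H_0
    and centralised by the earlier factors, and counting orders gives the trivial intersection. *)
Lemma retraction_vgrp i : 0 < i -> exists2 r : vgrp N i.+1 -> vgrp N i,
  {morph r : x y / x * y} & cancel (@inc N i i.+1) r.
Proof.
move=> i0; have ii1 : 0 < i <= i.+1 by rewrite i0 leqnSn.
have [U [nHU split]] := hsplit.
have incM := @inc_morph N i i.+1 ii1; have incI := @inc_inj N i i.+1 ii1.
apply: (sdprod_retraction (K := U i.+1)) => //.
have := split i.+1 isT; rewrite big_nat_recr //=; have := split i i0.
set P := \big[dprod/1]_(1 <= j < i.+1) (@inc N j i @: U j).
set Q := \big[dprod/1]_(1 <= j < i.+1) (@inc N j i.+1 @: U j).
move=> PH QUH.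
have idU : @inc N i.+1 i.+1 @: U i.+1 = U i.+1.
  by rewrite -[RHS]imset_id; apply: eq_imset; exact: inc_id.
rewrite idU in QUH.
pose M := Group (morph_imset_group_set [group of [set: vgrp N i]] incM).
have HE : egrp0_in N i.+1 = @inc N i i.+1 @: egrp0_in N i by rewrite inc_imset ?i0.
have [[K H defK defH] KHT nKH tKH] := sdprodP QUH.
have tKH' : K :&: H = 1 by rewrite -defK -defH.
have [[Q' U' defQ defU] QUK cQU tQU] := dprodP defK.
have [[P' H' defP defH'] _ _ _] := sdprodP PH.
have cardPQ : #|P| = #|Q|.
  rewrite defP defQ -(bigdprod_card defP) -(bigdprod_card defQ).
  apply: eq_big_nat => j /andP[j0]; rewrite ltnS => ji; rewrite !card_imset //.
    by apply: inc_inj; rewrite j0 ltnW.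
  by apply: inc_inj; rewrite j0.
have cardM : #|M| = (#|Q| * #|H|)%N.
  by rewrite /= card_imset // -(sdprod_card PH) cardPQ -defH HE [in RHS]card_imset.
have QM : Q \subset M.
  rewrite defQ -(bigdprodWY defQ) gen_subG big_seq_cond.
  elim/big_ind: _ => [|A B AM BM|j]; rewrite ?finset.sub0set ?finset.subUset ?AM ?BM //.
  rewrite mem_index_iota andbT => /andP[j0 ji].
  by rewrite -(@inc_imset j i i.+1) ?j0 //; apply/imsetS/finset.subsetT.
have HM : H \subset M by rewrite -defH HE; apply/imsetS/finset.subsetT.
have tQH : Q' :&: H = 1.
  apply/trivgP; rewrite -tKH defK defH finset.setSI // -QUK defQ defU; exact: mulG_subl.
have QHM : Q' * H = M.
  apply/eqP; rewrite eqEcard mul_subG //= -?defQ //.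
  by rewrite defQ TI_cardMg // -defQ -cardM.
rewrite -[f in _ ><| f]/(M : {set _}).
have UMT : U i.+1 * M = [set: vgrp N i.+1].
  rewrite -QHM mulgA -KHT defK -QUK defQ defH; congr (_ * _).
  by apply: centC; rewrite -defQ.
have cardUM : #|U i.+1 * M| = (#|U i.+1| * #|M|)%N.
  rewrite UMT -KHT defK defH (TI_cardMg tKH') -QUK defQ defU.
  by rewrite TI_cardMg -?defQ -?defU // cardM mulnA [(#|Q| * _)%N]mulnC.
rewrite sdprodE ?(cardMg_TI _) ?cardUM // -QHM mul_subG //.
  by apply: (fintype.subset_trans _ (cent_sub _)); rewrite centsC -defQ.
by rewrite -defH; exact: nHU.
Qed.

End Retractions.

Local Open Scope classical_set_scope.

(** * The fundamental group and the adjacency relation *)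

Section Pi1.
Variable N : nagao_ray.
Implicit Types (g h : pi1 N) (v w : vertex N).

Lemma vembM i (x y : vgrp N i) : vemb (x * y) = vemb x * vemb y.
Proof. by rewrite [RHS]pi1_mulE; apply/esym/pi1_ofP/word_eq_mul. Qed.

Lemma vemb1 i : vemb (1 : vgrp N i) = 1.
Proof. exact/pi1_ofP/word_eq_one. Qed.

Lemma vembV i (x : vgrp N i) : vemb x^-1 = (vemb x)^-1.
Proof. by apply: (mulgI (vemb x)); rewrite -vembM !mulgV vemb1. Qed.

Lemma vemb_edge0 (h : egrp0 N) : vemb (h0 N h) = vemb (h1 N h).
Proof. exact/pi1_ofP/word_eq_edge0. Qed.

Lemma vemb_edge i (x : vgrp N i) : 0 < i -> vemb (@inc N i i.+1 x) = vemb x.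
Proof. by move=> i0; apply/esym/pi1_ofP/word_eq_edge. Qed.

Lemma vemb_inc i j (x : vgrp N i) : 0 < i <= j -> vemb (@inc N i j x) = vemb x.
Proof.
move=> /andP[i0]; elim: j => [|j IH]; first by rewrite leqn0 => /eqP i_0; rewrite i_0 in i0.
rewrite leq_eqVlt => /orP[/eqP <-|ij]; first by rewrite inc_id.
rewrite -(inc_comp (i := i) (j := j)) ?i0 //= vemb_edge ?IH //.
exact: leq_trans i0 ij.
Qed.

Lemma pi1_cons (a : letter N) u : pi1_of (a :: u) = vemb (tagged a) * pi1_of u.
Proof. by case: a => i x; rewrite [RHS]pi1_mulE. Qed.

Lemma bvertex_eq g h i : bvertex g i = bvertex h i <-> exists x, h = g * @vemb N i x.
Proof.
split=> [[]|[x ->]].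
  move=> /(congr1 (fun A => A h)) E.
  have : gcoset h (@vstab N i) h by exists 1; [exists 1; rewrite ?vemb1 | rewrite mulg1].
  by rewrite -E => -[_ [x _ <-] <-]; exists x.
apply: vertexP => //=; apply/seteqP; split=> _ [_ [y _ <-] <-].
  exists (vemb (x^-1 * y)); first by exists (x^-1 * y).
  by rewrite -mulgA -vembM mulKVg.
by exists (vemb (x * y)); [exists (x * y) | rewrite vembM mulgA].
Qed.

Lemma bvertexM g i (x : vgrp N i) : bvertex (g * vemb x) i = bvertex g i.
Proof. by apply/esym/bvertex_eq; exists x. Qed.

Lemma adjP v w : adj v w <->
  exists g i, (v = bvertex g i /\ w = bvertex g i.+1) \/
              (w = bvertex g i /\ v = bvertex g i.+1).
Proof. by split=> [/asboolP|H] //; apply/asboolP. Qed.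

Lemma adjS g i : adj (bvertex g i) (bvertex g i.+1).
Proof. by apply/adjP; exists g, i; left. Qed.

Lemma adj_level v w : adj v w -> level w = (level v).+1 \/ level v = (level w).+1.
Proof. by move=> /adjP[g [i [[-> ->]|[-> ->]]]]; [left|right]. Qed.

(** For i > 0 the edge from x_i to x_(i+1) carries all of G_i, so the stabiliser of a vertex fixes
    its upper neighbour. *)
Lemma up_neighbour_unique v w w' : 0 < level v -> adj v w -> adj v w' ->
  level w = (level v).+1 -> level w' = (level v).+1 -> w = w'.
Proof.
move=> v0.
have up z : adj v z -> level z = (level v).+1 ->
    exists g, v = bvertex g (level v) /\ z = bvertex g (level v).+1.
  move=> /adjP[g [i [[-> ->]|[-> ->]]]] /=; first by exists g.
  by move=> /eqP; rewrite eqn_leq ltnNge leqnSn andbF.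
move=> /up uw /up uw' /uw[g [vg ->]] /uw'[g' [vg' ->]].
rewrite vg in vg'; move: vg' => /bvertex_eq[x ->].
by rewrite -(@vemb_edge _ x) // bvertexM.
Qed.

End Pi1.

(** * Transducers *)

(* A right action of the fundamental group on [E] by [step], with a cocycle
   [emit e] for it that maps each vertex group to itself. *)
Record transducer (N : nagao_ray) (E : Type) := Transducer {
  step : forall j, E -> vgrp N j -> E;
  emit : forall j, E -> vgrp N j -> vgrp N j;
  step1 : forall j e, @step j e 1 = e;
  stepM : forall j e (x y : vgrp N j), step e (x * y) = step (step e x) y;
  emitM : forall j e (x y : vgrp N j), emit e (x * y) = emit e x * emit (step e x) y;
  step_edge0 : forall e h, step e (h0 N h) = step e (h1 N h);
  emit_h0 : forall e h, emit e (h0 N h) = h0 N h;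
  emit_h1 : forall e h, emit e (h1 N h) = h1 N h;
  step_edge : forall j e (x : vgrp N j), 0 < j -> step e (@inc N j j.+1 x) = step e x;
  emit_edge : forall j e (x : vgrp N j), 0 < j ->
    emit e (@inc N j j.+1 x) = @inc N j j.+1 (emit e x)
}.

Section Transducers.
Variables (N : nagao_ray) (E : Type).
Implicit Types (M : transducer N E) (e : E) (g h : pi1 N) (u v : word N).

Lemma pi1_letter_ind (P : pi1 N -> Prop) :
  P 1 -> (forall i (x : vgrp N i) g, P g -> P (vemb x * g)) -> forall g, P g.
Proof.
move=> P1 PM; elim/pi1_ind=> u; elim: u => [|[i x] u IH] //.
by rewrite pi1_cons; exact: PM.
Qed.

Definition run_word M e u : E := foldl (fun e (a : letter N) => step M e (tagged a)) e u.

Fixpoint out_word M e u : pi1 N :=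
  if u is a :: v then vemb (emit M e (tagged a)) * out_word M (step M e (tagged a)) v
  else 1.

Lemma run_word_cat M e u v : run_word M e (u ++ v) = run_word M (run_word M e u) v.
Proof. exact: foldl_cat. Qed.

Lemma out_word_cat M e u v :
  out_word M e (u ++ v) = out_word M e u * out_word M (run_word M e u) v.
Proof. by elim: u e => [|a u IH] e /=; rewrite ?mul1g // IH mulgA. Qed.

Lemma emit1 M j e : emit M e (1 : vgrp N j) = 1.
Proof. by apply: (mulgI (emit M e 1)); rewrite -{2}[e](step1 M j) -emitM !mulg1. Qed.

Lemma run_out_word_eq M u v : word_eq u v ->
  forall e, run_word M e u = run_word M e v /\ out_word M e u = out_word M e v.
Proof.
elim=> {u v} [u|u v _ IH|u v w _ IH1 _ IH2|u u' v v' _ IH1 _ IH2|i|i x y|h|i x i0] e //=.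
- by have [-> ->] := IH e.
- by have [-> ->] := IH1 e.
- rewrite !run_word_cat !out_word_cat; have [-> ->] := IH1 e.
  by have [-> ->] := IH2 (run_word M e u').
- by rewrite step1 emit1 vemb1 mulg1.
- by rewrite stepM emitM vembM !mulg1.
- by rewrite step_edge0 emit_h0 emit_h1 vemb_edge0.
- by rewrite step_edge // emit_edge // vemb_edge.
Qed.

Definition run M e g : E := run_word M e (generic_quotient.repr g).
Definition out M e g : pi1 N := out_word M e (generic_quotient.repr g).

Lemma runE M e u : run M e (pi1_of u) = run_word M e u.
Proof. by have [] := run_out_word_eq M (pi1_repr u) e. Qed.

Lemma outE M e u : out M e (pi1_of u) = out_word M e u.
Proof. by have [] := run_out_word_eq M (pi1_repr u) e. Qed.

Lemma run1 M e : run M e 1 = e. Proof. exact: (runE M e [::]). Qed.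
Lemma out1 M e : out M e 1 = 1. Proof. exact: (outE M e [::]). Qed.

Lemma run_vemb M e j (x : vgrp N j) : run M e (vemb x) = step M e x.
Proof. exact: (runE M e [:: lett x]). Qed.

Lemma out_vemb M e j (x : vgrp N j) : out M e (vemb x) = vemb (emit M e x).
Proof. by rewrite outE /= mulg1. Qed.

Lemma runM M e g h : run M e (g * h) = run M (run M e g) h.
Proof.
elim/pi1_ind: g => u; elim/pi1_ind: h => v.
by rewrite [_ * _]pi1_mulE !runE run_word_cat.
Qed.

Lemma outM M e g h : out M e (g * h) = out M e g * out M (run M e g) h.
Proof.
elim/pi1_ind: g => u; elim/pi1_ind: h => v.
by rewrite [in LHS]/mulg /= pi1_mulE !outE runE out_word_cat.
Qed.

Lemma run_invariant M (P : E -> Prop) :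
  (forall j e (x : vgrp N j), P e -> P (step M e x)) ->
  forall e g, P e -> P (run M e g).
Proof.
move=> PS e g Pe; elim/pi1_letter_ind: g e Pe => [|j x g IH] e Pe; first by rewrite run1.
by rewrite runM run_vemb; apply/IH/PS.
Qed.

(** [M'] decodes what [M] emits while passing through the same states. *)
Definition mutually_inverse M M' := forall j e (x : vgrp N j),
  step M' e (emit M e x) = step M e x /\ emit M' e (emit M e x) = x.

Lemma out_inverse M M' e g : mutually_inverse M M' ->
  run M' e (out M e g) = run M e g /\ out M' e (out M e g) = g.
Proof.
move=> MM'; elim/pi1_letter_ind: g e => [|j x g IH] e; first by rewrite !out1 !run1.
rewrite !(outM, runM) !run_vemb !out_vemb run_vemb.
by have [-> ->] := MM' j e x; have [-> ->] := IH (step M e x).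
Qed.

(** Vertex groups are finite, so injective emissions are bijective; the inverse decodes each letter
    and then moves as [M] does. *)
Lemma transducer_inverse M : (forall j e, injective (@emit _ _ M j e)) ->
  exists M', mutually_inverse M M' /\ mutually_inverse M' M.
Proof.
move=> inj; pose em' j e (x : vgrp N j) := invF (inj j e) x.
pose st' j e (x : vgrp N j) := step M e (em' j e x).
have emK j e x : em' j e (emit M e x) = x by exact: invF_f.
have em'K j e x : emit M e (em' j e x) = x by exact: f_invF.
have emM j e x y : em' j e (x * y) = em' j e x * em' j (st' j e x) y.
  by apply: (inj j e); rewrite emitM !em'K.
have h0E e (h : egrp0 N) : em' _ e (h0 N h) = h0 N h by rewrite -{1}(emit_h0 M e) emK.
have h1E e (h : egrp0 N) : em' _ e (h1 N h) = h1 N h by rewrite -{1}(emit_h1 M e) emK.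
have incE j e (x : vgrp N j) : 0 < j -> em' _ e (@inc N j j.+1 x) = @inc N j j.+1 (em' j e x).
  by move=> j0; apply: (inj _ e); rewrite em'K emit_edge ?em'K.
unshelve eexists (@Transducer N E st' em' _ _ emM _ h0E h1E _ incE).
- by move=> j e; rewrite /st' -{1}(emit1 M j e) emK step1.
- by move=> j e x y; rewrite /st' emM stepM.
- by move=> e h; rewrite /st' h0E h1E step_edge0.
- by move=> j e x j0; rewrite /st' incE ?step_edge.
by split=> j e x /=; rewrite /st' ?emK ?em'K.
Qed.

End Transducers.

(** * Residual finiteness *)

Section ResidualFiniteness.
Variable N : nagao_ray.
Hypothesis hsplit : directly_split N.

Lemma vgrp_projections n : 0 < n -> exists p : forall j, vgrp N j -> vgrp N n,
  [/\ forall j, 0 < j -> {morph p j : x y / x * y},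
      forall j x, 0 < j -> p j.+1 (@inc N j j.+1 x) = p j x &
      forall j x, 0 < j <= n -> p j x = @inc N j n x].
Proof.
move=> n0.
have rhoP i : exists r : vgrp N i.+1 -> vgrp N i, 0 < i ->
    {morph r : x y / x * y} /\ cancel (@inc N i i.+1) r.
  case: (posnP i) => [->|i0]; first by exists (fun=> 1).
  by have [r rM rK] := retraction_vgrp hsplit i0; exists r.
pose rho i := projT1 (cid (rhoP i)).
have rhoE i : 0 < i -> {morph rho i : x y / x * y} /\ cancel (@inc N i i.+1) (rho i).
  exact: projT2 (cid (rhoP i)).
(* Up to n this is the inclusion, beyond n a composite of one-step retractions; the value at 0 is a
   filler, as all claims concern positive indices. *)
pose p := fix p j : vgrp N j -> vgrp N n :=
  match j with
  | 0 => fun=> 1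
  | k.+1 => fun x => if k < n then @inc N k.+1 n x else p k (rho k x)
  end.
have p_inc j x : 0 < j <= n -> p j x = @inc N j n x.
  by case: j x => // j x /=; case: ifP.
exists p; split=> // [j j0|j x j0].
- elim: j j0 => // j IH _ x y /=; case: ltnP => [jn|nj]; first by rewrite inc_morph.
  have j0 := leq_trans n0 nj.
  by have [rM _] := rhoE j j0; rewrite rM IH.
- rewrite /= ; case: ltnP => jn; last by have [_ ->] := rhoE j j0.
  have := @inc_comp N j j.+1 n; rewrite j0 leqnSn => /(_ isT jn x) /= ->.
  by rewrite p_inc ?j0 ?(ltnW jn).
Qed.

Lemma egrp0_projections : exists p : forall j, vgrp N j -> egrp0 N,
  [/\ forall j, 0 < j -> {morph p j : x y / x * y},
      forall j x, 0 < j -> p j.+1 (@inc N j j.+1 x) = p j x &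
      forall h, p 1%N (h1 N h) = h].
Proof.
have [p [pM p_inc p1]] := @vgrp_projections 1%N isT.
have [r rM rK] := retraction_egrp0 hsplit.
exists (fun j x => r (p j x)); split=> [j j0 x y|j x j0|h].
- by rewrite pM // rM.
- by rewrite p_inc.
- by rewrite p1 // inc_id // rK.
Qed.

Lemma h0M : {morph h0 N : x y / x * y}.
Proof. by move=> x y; rewrite morphM ?inE. Qed.

Lemma h1M : {morph h1 N : x y / x * y}.
Proof. by move=> x y; rewrite morphM ?inE. Qed.

(** Write a as a chosen representative of the coset a H_0 times an element of H_0; that element is
    [eta a]. *)
Lemma egrp0_section : exists eta : vgrp N 0 -> egrp0 N,
  forall a h, eta (a * h0 N h) = eta a * h.
Proof.
pose H := [group of h0 N @* [set: egrp0 N]%SET].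
have etaP a : exists h, h0 N h == (fingroup.repr (a *: H))^-1 * a.
  have /lcosetP[b Hb ->] := mem_repr a (lcoset_refl H a).
  rewrite invMg -mulgA mulVg mulg1; have := groupVr Hb.
  by case/morphimP=> h _ _ ->; exists h.
exists (fun a => xchoose (etaP a)) => a h; apply: (@h0_inj N).
rewrite h0M !(eqP (xchooseP (etaP _))) -mulgA; congr (_^-1 * _).
by rewrite lcosetM (lcoset_id (_ : h0 N h \in H)) ?mem_morphim ?inE.
Qed.

Definition labelled_action (E : Type) (st : forall j, E -> vgrp N j -> E) : Prop :=
  [/\ forall j e, @st j e 1 = e,
      forall j e (x y : vgrp N j), st j e (x * y) = st j (st j e x) y,
      forall e h, st 0 e (h0 N h) = st 1%N e (h1 N h) &
      forall j e (x : vgrp N j), 0 < j -> st j.+1 e (@inc N j j.+1 x) = st j e x].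

Lemma transducer_of_action (E : Type) (st : forall j, E -> vgrp N j -> E) :
  labelled_action st ->
  exists M : transducer N E, forall j e (x : vgrp N j), step M e x = st j e x.
Proof.
move=> [st1 stM st0 stS].
by exists (@Transducer N E st (fun _ _ x => x) st1 stM (fun _ _ _ _ => erefl) st0
  (fun _ _ => erefl) (fun _ _ => erefl) stS (fun _ _ _ _ => erefl)).
Qed.

(* Separates the vertex groups: the first component sees [vgrp N 0], the second
   [vgrp N n], and [eta] makes the two actions agree on H_0. *)
Lemma amalgam_action n : 0 < n ->
  exists (M : transducer N (vgrp N 0 * vgrp N n)) (p : forall j, vgrp N j -> egrp0 N),
  [/\ forall x : vgrp N 0, (step M (1, 1) x).1 = x,
      forall j (x : vgrp N j), 0 < j -> (step M (1, 1) x).1 = h0 N (p j x) &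
      forall x : vgrp N n, (step M (1, 1) x).2 = x].
Proof.
case: n => // n n0; have [p [pM p_inc pE]] := vgrp_projections n0.
have [r [rM r_inc r1]] := egrp0_projections.
have [eta etaM] := egrp0_section.
pose emb h := @inc N 1 n.+1 (h1 N h).
have embM : {morph emb : x y / x * y} by move=> x y; rewrite /emb h1M inc_morph.
pose st j (e : vgrp N 0 * vgrp N n.+1) : vgrp N j -> vgrp N 0 * vgrp N n.+1 :=
  match j with
  | 0 => fun x => (e.1 * x, e.2 * emb ((eta e.1)^-1 * eta (e.1 * x)))
  | k.+1 => fun x => (e.1 * h0 N (r k.+1 x), e.2 * p k.+1 x)
  end.
have stA : labelled_action st.
  split=> [[|j] [a b]|[|j] [a b] x y|[a b] h|[|j] [a b] x] //=.
  - by rewrite mulg1 mulVg fun_morph1 // mulg1.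
  - by rewrite (fun_morph1 (pM j.+1 isT)) (fun_morph1 (rM j.+1 isT)) (fun_morph1 h0M) !mulg1.
  - by rewrite -[b * _ * _]mulgA -embM !mulgA mulgK.
  - by rewrite rM // pM // h0M !mulgA.
  - by rewrite etaM mulKg r1 pE.
  - by move=> _; rewrite r_inc // p_inc.
have [M MP] := transducer_of_action stA; exists M, r.
split=> [x|[|j] x|x]; rewrite ?MP /= ?mul1g //.
by rewrite pE ?leqnn ?inc_id.
Qed.

(** The image of (1, 1) in the action above records the element in one component. *)
Lemma vemb_inj i : injective (@vemb N i).
Proof.
case: i => [|i] x y xy.
  have [M [p [M0 _ _]]] := @amalgam_action 1%N isT.
  by have := congr1 (run M (1, 1)) xy; rewrite !run_vemb => /(congr1 fst); rewrite !M0.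
have [M [p [_ _ M2]]] := @amalgam_action i.+1 isT.
by have := congr1 (run M (1, 1)) xy; rewrite !run_vemb => /(congr1 snd); rewrite !M2.
Qed.

Lemma vemb_meet i (a : vgrp N 0) (b : vgrp N i) : 0 < i -> vemb a = vemb b ->
  exists2 h, a = h0 N h & b = @inc N 1 i (h1 N h).
Proof.
move=> i0 ab; have [M [p [M0 M1 _]]] := @amalgam_action 1%N isT.
have aE : a = h0 N (p i b).
  by rewrite -M1 // -[LHS]M0 -!run_vemb ab.
exists (p i b) => //; apply: vemb_inj; rewrite -ab vemb_inc ?i0 //.
by rewrite -vemb_edge0 -aE.
Qed.

(* Right multiplication on pi1 is cut off outside the finite set [Y]: the B-orbits
   that leave [Y] only see the retraction B -> H_0, where B = [vgrp N n].  Since [Y]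
   is stable under [vgrp N 0], it contains the orbit of 1; since it contains the full
   B-orbits of all prefixes of the given elements, these act on 1 as in pi1. *)
Lemma residually_finite (s : seq (pi1 N)) :
  exists2 M : transducer N (pi1 N), finite_set (range (run M 1)) &
    forall g, g \in s -> run M 1 g = 1 -> g = 1.
Proof.
(* The empty word makes 1 a prefix; the successor keeps [n] positive. *)
pose ws : seq (word N) := [::] :: [seq generic_quotient.repr g | g <- s].
pose n := (\max_(a <- flatten ws) tag a).+1.
have ws_n w a : w \in ws -> a \in w -> tag a <= n.
  move=> ww aw; apply: leqW.
  by apply: (@leq_bigmax_seq _ _ xpredT tag a) => //; apply/flattenP; exists w.
have [p [pM p_inc pE]] := @vgrp_projections n isT.
have [r [rM r_inc r1]] := egrp0_projections.
pose Q : seq (pi1 N) := [seq pi1_of (take k w) | w <- ws, k <- iota 0 (size w).+1].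
pose Y := [set y | exists q (b : vgrp N n) (a : vgrp N 0),
  q \in Q /\ y = q * vemb b * vemb a].
have QP u v : u ++ v \in ws -> pi1_of u \in Q.
  move=> uv; apply/allpairsPdep; exists (u ++ v), (size u); split=> //.
    by rewrite mem_iota /= add0n ltnS size_cat leq_addr.
  by rewrite take_size_cat.
have Q1 : 1 \in Q by apply: (QP [::] [::]); rewrite inE.
have Yfin : finite_set Y.
  apply: (@sub_finite_set _ _
    ((fun z => z.1.1 * @vemb N n z.1.2 * @vemb N 0 z.2) @` ([set` Q] `*` setT `*` setT))).
    by move=> _ [q [b [a [qQ ->]]]]; exists (q, b, a).
  by apply/finite_image/finite_setX => //; apply/finite_setX.
have Y0 y (a : vgrp N 0) : Y y -> Y (y * vemb a).
  by move=> [q [b [a' [qQ ->]]]]; exists q, b, (a' * a); rewrite vembM mulgA.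
pose full y := forall b : vgrp N n, Y (y * vemb b).
have fullM y (b : vgrp N n) : full (y * vemb b) <-> full y.
  split=> yF c; last by rewrite -mulgA -vembM; exact: yF.
  by have := yF (b^-1 * c); rewrite -mulgA -vembM mulKVg.
have fullQ q : q \in Q -> full q.
  by move=> qQ b; exists q, b, 1; rewrite vemb1 mulg1.
pose st j (y : pi1 N) : vgrp N j -> pi1 N :=
  match j with
  | 0 => fun x => y * vemb x
  | k.+1 => fun x => y * if `[< full y >] then vemb (p k.+1 x) else vemb (h1 N (r k.+1 x))
  end.
have vemb_h1 h : vemb (h1 N h) = vemb (@inc N 1 n (h1 N h)) by rewrite vemb_inc.
(* At positive levels both branches of [st] move y inside its B-coset, since H_0 embeds in B; so
   fullness is constant along orbits and [st] is an action. *)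
have full_st k y x : full (st k.+1 y x) <-> full y.
  by rewrite /st; case: ifP => _; rewrite ?vemb_h1 fullM.
have stA : labelled_action st.
  split=> [[|j] y|[|j] y a b|y h|[|j] y x] //.
  - by rewrite /= vemb1 mulg1.
  - by rewrite /= (fun_morph1 (pM j.+1 isT)) (fun_morph1 (rM j.+1 isT)) (fun_morph1 h1M)
      !vemb1 if_same mulg1.
  - by rewrite /= vembM mulgA.
  - have -> : st j.+1 (st j.+1 y a) b = st j.+1 y a *
        if `[< full y >] then vemb (p j.+1 b) else vemb (h1 N (r j.+1 b)).
      by rewrite {1}/st (asbool_equiv_eq (full_st j y a)).
    rewrite /st pM // rM // h1M !vembM.
    by case: ifP => _; rewrite mulgA.
  - by rewrite /= pE // -vemb_h1 r1 if_same vemb_edge0.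
  - by move=> j0; rewrite /= p_inc // r_inc.
have [M MP] := transducer_of_action stA; exists M.
  apply: sub_finite_set Yfin => _ [g _ <-].
  apply: run_invariant => [[|j] y x yY|]; last by exists 1, 1, 1; rewrite !vemb1 !mulg1.
    by rewrite MP; exact: Y0.
  rewrite MP /st; case: ifPn => [/asboolP yF|_]; first exact: yF.
  by rewrite -vemb_edge0; exact: Y0.
(* Prefixes are full, so the letters of the chosen words act by true right multiplication and lead
   from 1 to each prefix. *)
have runP u v : u ++ v \in ws -> run M 1 (pi1_of u) = pi1_of u.
  elim/last_ind: u v => [|u [j x] IH] v uv; first exact: run1.
  rewrite cat_rcons in uv.
  rewrite -cats1 -pi1_mulE runM (IH _ uv).
  rewrite run_vemb MP; case: j x uv => [|j] x uv //.
  rewrite /st ifT; last by apply/asboolP/fullQ; exact: QP uv.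
  have jn : j.+1 <= n.
    by apply: (ws_n _ (existT _ j.+1 x) uv); rewrite mem_cat inE eqxx orbT.
  by rewrite pE // vemb_inc.
move=> g gs; rewrite -[g in run _ _ g]pi1_reprK (runP _ [::]) ?pi1_reprK //.
by rewrite cats0 inE map_f ?orbT.
Qed.

End ResidualFiniteness.

(** * The commensurator *)

Section Commensurator.
Variables (G : groupType) (S : set G).
Hypotheses (S1 : S 1) (SM : forall x y, S x -> S y -> S (x * y))
  (SV : forall x, S x -> S x^-1).

(** The double coset S g S lies in finitely many left cosets x S; in this form the condition passes
    directly to products. *)
Definition finitely_many_cosets g := exists2 A : set G, finite_set A &
  forall s, S s -> exists2 x, A x & S (x^-1 * (s * g)).

Lemma gcosetI_conj g k : gcoset k (S `&` [set g * s * g^-1 | s in S]) =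
  [set y | S (k^-1 * y) /\ S (g^-1 * (k^-1 * y) * g)].
Proof.
apply/seteqP; split=> [_ [h [Sh [s Ss sh]] <-]|y [Sy gSy]] /=.
  by rewrite mulKg; split=> //; rewrite -sh !mulgA mulVg mul1g mulgVK.
exists (k^-1 * y); last by rewrite mulVKg.
split=> //; exists (g^-1 * (k^-1 * y) * g) => //.
by rewrite !mulgA mulgV mul1g mulgK.
Qed.

(** For k in S, the coset of k modulo the intersection corresponds to the coset k g S; the other
    index is treated by g^-1. *)
Lemma commensuratorP g : commensurator S g <->
  finitely_many_cosets g /\ finitely_many_cosets g^-1.
Proof.
set H := S `&` [set g * s * g^-1 | s in S].
have HE k y : gcoset k H y <-> S (k^-1 * y) /\ S (g^-1 * (k^-1 * y) * g).
  by rewrite gcosetI_conj.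
split=> [[fin1 fin2]|[[A Afin AP] [B Bfin BP]]].
- have rep k : gcoset k H (xget 1 (gcoset k H)).
    apply: xgetPex; exists k; apply/HE; rewrite mulVg mulg1 mulVg; by split.
  split.
    exists ((fun C => xget 1 C * g) @` [set gcoset k H | k in S]).
      exact: finite_image.
    move=> s Ss; exists (xget 1 (gcoset s H) * g).
      by exists (gcoset s H) => //; exists s.
    have /HE[_ /SV] := rep s.
    by rewrite !invMg !invgK !mulgA.
  exists ((fun C => g^-1 * xget 1 C) @` [set gcoset k H | k in [set g * s * g^-1 | s in S]]).
    exact: finite_image.
  move=> s Ss; exists (g^-1 * xget 1 (gcoset (g * s * g^-1) H)).
    by exists (gcoset (g * s * g^-1) H) => //; exists (g * s * g^-1) => //; exists s.
  have /HE[/SV + _] := rep (g * s * g^-1).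
  by rewrite !invMg !invgK !mulgA.
- split.
    apply: (@sub_finite_set _ _ ((fun x => [set k | S k /\ S (x^-1 * (k * g))]) @` A));
      last exact: finite_image.
    move=> _ [k Sk <-]; have [x Ax Sx] := AP k Sk; exists x => //.
    apply/seteqP; split=> [y [Sy xy]|y /HE[Sy gSy]].
      apply/HE; split; first by apply: SM => //; exact: SV.
      have := SM (SV Sx) xy; rewrite !invMg !invgK !mulgA.
      by rewrite mulgK.
    split; first by have := SM Sk Sy; rewrite mulVKg.
    by have := SM Sx gSy; rewrite !mulgA mulgK mulgK.
  apply: (@sub_finite_set _ _
    ((fun x => [set k | S (g^-1 * k * g) /\ S (x^-1 * (g^-1 * k))]) @` B));
    last exact: finite_image.
  move=> _ [_ [s Ss <-] <-]; have [x Bx Sx] := BP s Ss; exists x => //.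
  apply/seteqP; split=> [y [Sy xy]|y /HE[Sy gSy]].
    apply/HE; split.
      by have := SM (SV Sx) xy; rewrite !invMg !invgK !mulgA mulgK.
    by have := SM (SV Ss) Sy; rewrite !invMg !invgK !mulgA mulVg mul1g.
  split.
    by have := SM Ss gSy; rewrite !invMg !invgK !mulgA mulgVK mulgV mul1g.
  by have := SM Sx Sy; rewrite !invMg !invgK !mulgA mulgVK mulgK.
Qed.

Lemma commensuratorV g : commensurator S g -> commensurator S g^-1.
Proof. by move=> /commensuratorP[? ?]; apply/commensuratorP; rewrite invgK. Qed.

Lemma finitely_many_cosetsM g h : finitely_many_cosets g -> finitely_many_cosets h ->
  finitely_many_cosets (g * h).
Proof.
move=> [A Afin AP] [B Bfin BP].
exists ((fun z => z.1 * z.2) @` (A `*` B)).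
  exact/finite_image/finite_setX.
move=> s /AP[x Ax /BP[y By Sy]]; exists (x * y); first by exists (x, y).
by rewrite invMg -mulgA (mulgA s) (mulgA x^-1).
Qed.

Lemma commensuratorM g h : commensurator S g -> commensurator S h -> commensurator S (g * h).
Proof.
move=> /commensuratorP[g1 g2] /commensuratorP[h1 h2]; apply/commensuratorP.
by rewrite invMg; split; exact: finitely_many_cosetsM.
Qed.

Lemma sub_commensurator g : S g -> commensurator S g.
Proof.
have cov x : S x -> finitely_many_cosets x.
  move=> Sx; exists [set 1]; first exact: finite_set1.
  by move=> s Ss; exists 1 => //; rewrite invg1 mul1g; exact: SM.
by move=> Sg; apply/commensuratorP; split; apply: cov => //; exact: SV.
Qed.

End Commensurator.

(** * The lattice in Aut(T) and automorphisms given by transducers *)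

Section Lattice.
Variable N : nagao_ray.

Lemma aut_ofM (g h : pi1 N) : aut_of (g * h) = aut_of g * aut_of h.
Proof. by apply: autP => v; exact: vactM. Qed.

Lemma lattice1 : nagao_lattice N 1.
Proof. by exists 1 => //; apply: autP => v; exact: vact1. Qed.

Lemma latticeM (x y : tree_aut N) :
  nagao_lattice N x -> nagao_lattice N y -> nagao_lattice N (x * y).
Proof. by move=> [g _ <-] [h _ <-]; exists (g * h) => //; exact: aut_ofM. Qed.

Lemma aut_ofV (g : pi1 N) : aut_of g^-1 = (aut_of g)^-1.
Proof.
apply: (mulgI (aut_of g)); rewrite -aut_ofM !mulgV.
by apply: autP => v; exact: vact1.
Qed.

Lemma latticeV (x : tree_aut N) : nagao_lattice N x -> nagao_lattice N x^-1.
Proof. by move=> [g _ <-]; exists g^-1 => //; exact: aut_ofV. Qed.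

Local Notation C := (commensurator (nagao_lattice N)).

Lemma commM (x y : tree_aut N) : C x -> C y -> C (x * y).
Proof. exact: (commensuratorM lattice1 latticeM latticeV). Qed.

Lemma commV (x : tree_aut N) : C x -> C x^-1.
Proof. exact: (commensuratorV lattice1 latticeM latticeV). Qed.

Lemma comm_aut_of (g : pi1 N) : C (aut_of g).
Proof. by apply: (sub_commensurator lattice1 latticeM latticeV); exists g. Qed.

Section TransducerAut.
Variable E : Type.
Implicit Types (M : transducer N E) (e : E).

(** The choice of representative is harmless because [emit] preserves each vertex group. *)
Definition vertex_map M e (v : vertex N) : vertex N :=
  bvertex (out M e (projT1 (cid (bvertexE v)))) (level v).

Lemma vertex_mapE M e g i : vertex_map M e (bvertex g i) = bvertex (out M e g) i.
Proof.
rewrite /vertex_map; case: cid => h /= /bvertex_eq[x ->].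
by rewrite outM out_vemb bvertexM.
Qed.

Lemma vertex_map_adj M e v w : adj v w -> adj (vertex_map M e v) (vertex_map M e w).
Proof.
by move=> /adjP[g [i [[-> ->]|[-> ->]]]]; rewrite !vertex_mapE;
  apply/adjP; exists (out M e g), i; [left|right].
Qed.

Lemma vertex_mapK M M' e : mutually_inverse M M' ->
  cancel (vertex_map M e) (vertex_map M' e).
Proof.
move=> MM' v; have [g ->] := bvertexE v; rewrite !vertex_mapE.
by have [_ ->] := out_inverse e g MM'.
Qed.

(* [c e * g = out M e g * c (run M e g)]: a finite orbit of states leaves
   finitely many cosets. *)
Lemma commensurates_transducer M (c : E -> tree_aut N) e :
  (forall e g i, c e (bvertex g i) = bvertex (out M e g) i) ->
  finite_set (range (run M e)) -> finitely_many_cosets (nagao_lattice N) (c e)^-1.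
Proof.
move=> cE fin; exists ((fun e' => (c e')^-1) @` range (run M e)).
  exact: finite_image.
(* Invert [c e * g^-1 = out M e g^-1 * c e'], where [e' = run M e g^-1]. *)
move=> _ [g _ <-]; exists (c (run M e g^-1))^-1.
  by exists (run M e g^-1) => //; exists g^-1.
exists (out M e g^-1)^-1 => //; rewrite invgK.
apply: (mulIg (c e)); rewrite -!mulgA mulVg mulg1.
apply: (mulgI (aut_of (out M e g^-1))).
rewrite mulgA aut_ofV mulgV mul1g; apply: autP => v; have [h ->] := bvertexE v.
rewrite !autM /= vact_bvertex !cE vact_bvertex.
by rewrite -outM mulKg.
Qed.

Lemma vertex_map_aut M M' e : mutually_inverse M M' -> mutually_inverse M' M ->
  exists c : tree_aut N, forall v, c v = vertex_map M e v.
Proof.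
move=> MM' M'M.
have bij : bijective (vertex_map M e) by exists (vertex_map M' e); exact: vertex_mapK.
have adjE v w : adj (vertex_map M e v) (vertex_map M e w) = adj v w.
  apply/idP/idP; last exact: vertex_map_adj.
  by move=> /(vertex_map_adj M' e); rewrite !(vertex_mapK e MM').
by exists (Defs.Aut bij adjE).
Qed.

(** The inverse automorphism comes from the inverse transducer, whose states stay in the same finite
    orbit, so both coset conditions hold. *)
Lemma transducer_aut M e : (forall j e, injective (@emit _ _ M j e)) ->
  finite_set (range (run M e)) ->
  exists2 c : tree_aut N, C c & forall g i, c (bvertex g i) = bvertex (out M e g) i.
Proof.
move=> /transducer_inverse[M' [MM' M'M]] fin.
have /choice[c cP] := fun e => vertex_map_aut e MM' M'M.
have /choice[c' c'P] := fun e => vertex_map_aut e M'M MM'.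
have cE e1 g i : c e1 (bvertex g i) = bvertex (out M e1 g) i by rewrite cP vertex_mapE.
have c'E e1 g i : c' e1 (bvertex g i) = bvertex (out M' e1 g) i by rewrite c'P vertex_mapE.
have cV : c' e = (c e)^-1.
  apply: (mulIg (c e)); rewrite mulVg; apply: autP => v.
  by rewrite autM c'P cP vertex_mapK.
have run' g : run M' e g = run M e (out M' e g).
  by have [-> _] := out_inverse e g M'M.
exists (c e) => //; apply/(commensuratorP lattice1 latticeM latticeV); split.
  rewrite -[c e]invgK -cV; apply: commensurates_transducer c'E _.
  by apply: sub_finite_set fin => _ [g _ <-]; exists (out M' e g).
exact: commensurates_transducer cE fin.
Qed.

End TransducerAut.
End Lattice.

(** * Exchanging two neighbours *)

Section Twist.
Variables (N : nagao_ray) (E : Type) (M : transducer N E).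

(** The identity cocycle altered by the coboundary of [t], separately on each vertex group. *)
Definition twisted (t : forall j, E -> vgrp N j) j (e : E) (x : vgrp N j) : vgrp N j :=
  (t j e)^-1 * x * t j (step M e x).

Lemma twisted_transducer (t : forall j, E -> vgrp N j) :
    (forall j e, t j (step M e (t j e)) = (t j e)^-1) ->
    (forall e h, twisted t e (h0 N h) = h0 N h) ->
    (forall e h, twisted t e (h1 N h) = h1 N h) ->
    (forall j e (x : vgrp N j), 0 < j ->
       twisted t e (@inc N j j.+1 x) = @inc N j j.+1 (twisted t e x)) ->
  exists M' : transducer N E,
    [/\ forall j e, injective (@emit _ _ M' j e),
        forall e g, run M' e g = run M e g &
        forall j e (x : vgrp N j), emit M' e x = twisted t e x].
Proof.
move=> tV t_h0 t_h1 t_inc.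
have tM j e (x y : vgrp N j) : twisted t e (x * y) = twisted t e x * twisted t (step M e x) y.
  by rewrite /twisted stepM !mulgA mulgK.
pose M' := @Transducer N E (@step _ _ M) (twisted t) (step1 M) (stepM M) tM
  (step_edge0 M) t_h0 t_h1 (@step_edge _ _ M) t_inc.
exists M'; split=> // j e x y /= xy.
pose s e := step M e (t j e).
have sK : involutive s by move=> e'; rewrite /s tV -stepM mulgV step1.
(* The emitted letter carries [s e] to [s] of the next state, so it determines that state and then
   x. *)
have sxy (z : vgrp N j) : step M (s e) (twisted t e z) = s (step M e z).
  by rewrite /s -stepM /twisted -mulgA mulVKg stepM.
have exy : step M e x = step M e y.
  by apply: (inv_inj sK); rewrite -!sxy xy.
by move: xy; rewrite /twisted exy => /mulIg/mulgI.
Qed.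

(* The stabiliser of [x_i] permutes transitively the neighbours of [x_i] on the
   level [nbr i]; for i > 0 the only other neighbour is [x_i+1]. *)
Definition nbr (i : nat) : nat := if i is k.+1 then k else 1.

(** The group of the edge from x_i to x_(nbr i), expressed inside the fundamental group so that i =
    0, i = 1 and i > 1 are treated alike. *)
Definition edge_elt i (x : vgrp N i) : Prop := exists y : vgrp N (nbr i), vemb x = vemb y.

(** The family carries [t] on the side of x_i away from x_(nbr i) and 1 on the other side;
    equivariance under the edge group reconciles the two across that edge. The truncated [i.-1] is
    the index of this edge on the ray, 0 for both i = 0 and i = 1. *)
Lemma twist_family i (t : E -> vgrp N i) :
    (forall e, t (step M e (t e)) = (t e)^-1) ->
    (forall e x, edge_elt x -> t (step M e x) = x^-1 * t e * x) ->
  exists2 M' : transducer N E,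
      (forall j e, injective (@emit _ _ M' j e)) /\ (forall e g, run M' e g = run M e g) &
    exists tt : forall j, E -> vgrp N j,
    [/\ forall j e (x : vgrp N j), emit M' e x = twisted tt e x,
        forall e, tt i e = t e &
        forall j e, t e = 1 \/ j != i.-1 -> vemb (tt j e) = vemb (tt j.+1 e)].
Proof.
case: i t => [|i] t tV tE.
  pose tt j : E -> vgrp N j := match j with 0 => t | k.+1 => fun=> 1 end.
  have [||||M' [inj runE emitE]] := @twisted_transducer tt.
  - by case=> [|j] e //=; rewrite invg1.
  - move=> e h; rewrite /twisted /= tE; last by exists (h1 N h); exact: vemb_edge0.
    by rewrite !mulgA mulgK mulVg mul1g.
  - by move=> e h; rewrite /twisted /= invg1 mul1g mulg1.
  - by case=> // j e x _; rewrite /twisted /= !invg1 !mul1g !mulg1.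
  exists M' => //; exists tt; split=> // -[|j] e /=; rewrite !vemb1 //.
  by case=> [->|//]; rewrite vemb1.
have incM j := @inc_morph N i.+1 j.
have inc1 j : i < j -> @inc N i.+1 j 1 = 1.
  by move=> ij; apply: fun_morph1; exact: incM.
have incV j x : i < j -> @inc N i.+1 j x^-1 = (@inc N i.+1 j x)^-1.
  by move=> ij; apply: (mulgI (@inc N i.+1 j x)); rewrite -incM ?ij // !mulgV inc1.
pose tt j e : vgrp N j := if i < j then @inc N i.+1 j (t e) else 1.
have tti e : tt i.+1 e = t e by rewrite /tt leqnn inc_id.
have tw_lt j e (x : vgrp N j) : j <= i -> twisted tt e x = x.
  by move=> ji; rewrite /twisted /tt ltnNge ji invg1 mul1g mulg1.
have tw_i e (x : vgrp N i.+1) : edge_elt x -> twisted tt e x = x.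
  by move=> Ax; rewrite /twisted !tti tE // !mulgA mulgK mulVg mul1g.
have stepS j e (x : vgrp N i.+1) : i < j -> step M e (@inc N i.+1 j x) = step M e x.
  by move=> ij; rewrite -!run_vemb vemb_inc.
have [||||M' [inj runE emitE]] := @twisted_transducer tt.
- move=> j e; rewrite /tt; case: ifP => ij; last by rewrite invg1.
  by rewrite ij stepS // tV incV.
- by move=> e h; exact: tw_lt.
- move=> e h; case: (posnP i) => [i_0|i0]; last exact: tw_lt.
  move: (i) i_0 (tw_i e) => k ->; apply.
  by exists (h0 N h); rewrite -vemb_edge0.
- move=> j e x j0; case: (ltngtP j i) => ji.
  + by rewrite !tw_lt // ltnW.
  + rewrite /twisted /tt ji ltnS (ltnW ji) step_edge //.
    have jj1 : 0 < j <= j.+1 by rewrite j0 leqnSn.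
    have incS y : @inc N i.+1 j.+1 y = @inc N j j.+1 (@inc N i.+1 j y).
      by rewrite -(inc_comp (i := i.+1) (j := j)).
    rewrite !incS !(inc_morph (i := j)) //; congr (_ * _ * _).
    by rewrite -(incV j) // -!incS incV // ltnS ltnW.
  + move: x j0; rewrite ji => x i0; rewrite [in RHS]tw_lt // tw_i //.
    by exists x; rewrite vemb_edge.
exists M' => //; exists tt; split=> // j e /= te.
rewrite /tt ltnS; case: (ltngtP j i) te => ji te; rewrite ?vemb1 //.
- by rewrite !vemb_inc ?ji //= leqW.
- by case: te => [->|]; rewrite ?eqxx // inc1 ?vemb1 ?ji.
Qed.

End Twist.

(** * Periodic exchanges at a vertex of the ray *)

Section Swaps.
Variable N : nagao_ray.
Hypothesis hsplit : directly_split N.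
Local Notation C := (commensurator (nagao_lattice N)).

Lemma edge_eltM i (x y : vgrp N i) : edge_elt x -> edge_elt y -> edge_elt (x * y).
Proof. by move=> [a xa] [b yb]; exists (a * b); rewrite !vembM xa yb. Qed.

Lemma edge_eltV i (x : vgrp N i) : edge_elt x -> edge_elt x^-1.
Proof. by move=> [a xa]; exists a^-1; rewrite !vembV xa. Qed.

Lemma edge_elt_bvertex i (a b : vgrp N i) :
  edge_elt (a^-1 * b) <-> bvertex (vemb a) (nbr i) = bvertex (vemb b) (nbr i).
Proof.
rewrite bvertex_eq; split=> -[y yE]; exists y.
  by rewrite -yE -vembM mulKVg.
by rewrite vembM vembV yE mulKg.
Qed.

Section LeftSwap.
Variables (i : nat) (a b : vgrp N i).
Hypothesis ab : ~ edge_elt (a^-1 * b).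

(* Left multiplication by [left_swap y] exchanges the cosets [a A] and [b A] of the
   edge group [A] and fixes all other cosets. *)
Definition left_swap (y : vgrp N i) : vgrp N i :=
  if `[< edge_elt (a^-1 * y) >] then b * a^-1
  else if `[< edge_elt (b^-1 * y) >] then a * b^-1 else 1.

Lemma left_swapMr y x : edge_elt x -> left_swap (y * x) = left_swap y.
Proof.
move=> Ax; rewrite /left_swap.
have E d : `[< edge_elt (d^-1 * (y * x)) >] = `[< edge_elt (d^-1 * y) >].
  apply/asbool_equiv_eq; rewrite mulgA; split=> [H|H]; last exact: edge_eltM.
  by rewrite -[_ * y](mulgK x); apply: edge_eltM => //; exact: edge_eltV.
by rewrite !E.
Qed.

Lemma left_swapK y : left_swap (left_swap y * y) = (left_swap y)^-1.
Proof.
rewrite {2 3}/left_swap; case: asboolP => [Aa|nAa].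
  rewrite /left_swap ifF; last first.
    apply/asboolP => H; apply: ab.
    have := edge_eltM H (edge_eltV Aa).
    by rewrite !invMg !invgK !mulgA mulgK mulgVK.
  by rewrite ifT ?invMg ?invgK //; apply/asboolP; rewrite !mulgA mulVg mul1g.
case: asboolP => [Ab|nAb].
  rewrite /left_swap ifT ?invMg ?invgK //; apply/asboolP.
  by rewrite !mulgA mulVg mul1g.
rewrite mul1g invg1 /left_swap.
by case: asboolP => // _; case: asboolP.
Qed.

Lemma left_swap_l : left_swap a = b * a^-1.
Proof. by rewrite /left_swap ifT //; apply/asboolP; exists 1; rewrite mulVg !vemb1. Qed.

Lemma left_swap_r : left_swap b = a * b^-1.
Proof.
rewrite /left_swap ifF; last by apply/asboolP.
by rewrite ifT //; apply/asboolP; exists 1; rewrite mulVg !vemb1.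
Qed.

Lemma left_swap_neq1 y : left_swap y <> 1 ->
  exists2 d, d = a \/ d = b & edge_elt (d^-1 * y).
Proof.
rewrite /left_swap; case: asboolP => [Aa _|_]; first by exists a; [left|].
by case: asboolP => [Ab _|//]; exists b; [right|].
Qed.

(** By residual finiteness G_i acts freely on the orbit of 1 in a finite G-set. On this orbit [t] is
    [left_swap] rewritten as a right multiplication, and elsewhere it is 1. *)
Lemma periodic_twist (s : seq (pi1 N)) :
  exists M : transducer N (pi1 N), exists t : pi1 N -> vgrp N i,
  [/\ finite_set (range (run M 1)),
      forall g, g \in s -> run M 1 g = 1 -> g = 1 &
   [/\ forall e, t (step M e (t e)) = (t e)^-1,
      forall e x, edge_elt x -> t (step M e x) = x^-1 * t e * x,
      forall y, t (run M 1 (vemb y)) = y^-1 * left_swap y * y &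
      forall e, t e <> 1 -> exists2 y : vgrp N i, e = run M 1 (vemb y) & left_swap y <> 1]].
Proof.
have [M fin sep] := residually_finite hsplit (s ++ [seq vemb y | y <- enum (vgrp N i)]).
pose t e := if [pick y : vgrp N i | `[< run M 1 (vemb y) = e >]] is Some y
  then y^-1 * left_swap y * y else 1.
have free (y z : vgrp N i) : run M 1 (vemb y) = run M 1 (vemb z) -> y = z.
  move=> yz; apply: (@vemb_inj _ hsplit i).
  apply/(mulIg (vemb z)^-1); rewrite mulgV -vembV -vembM; apply: sep.
    by rewrite mem_cat map_f ?orbT // mem_enum.
  by rewrite vembM runM yz -runM -vembM mulgV vemb1 run1.
have tE y : t (run M 1 (vemb y)) = y^-1 * left_swap y * y.
  rewrite /t; case: pickP => [z /asboolP /free -> //|/(_ y)].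
  by rewrite asboolT.
have stepE (y x : vgrp N i) : step M (run M 1 (vemb y)) x = run M 1 (vemb (y * x)).
  by rewrite vembM runM (run_vemb M _ x).
have orbitP e : (exists y : vgrp N i, e = run M 1 (vemb y)) \/ t e = 1.
  rewrite /t; case: pickP => [y /asboolP <-|_]; last by right.
  by left; exists y.
exists M, t; split=> //; first by move=> g gs; apply: sep; rewrite mem_cat gs.
split=> // [e|e x Ax|e te].
- have [[y ->]|te] := orbitP e; last by rewrite te step1 te invg1.
  rewrite tE stepE !mulgA mulgV mul1g tE left_swapK !invMg !invgK !mulgA.
  by rewrite mulgVK.
- have [[y ->]|te] := orbitP e.
    by rewrite stepE !tE left_swapMr // invMg !mulgA.
  rewrite te mulg1 mulVg; have [[y eE]|//] := orbitP (step M e x).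
  have eE' : e = run M 1 (vemb (y * x^-1)) by rewrite -stepE -eE -stepM mulgV step1.
  have := te; rewrite eE' stepE mulgVK !tE left_swapMr; last exact: edge_eltV.
  move=> /(congr1 (fun z => x^-1 * z * x)); rewrite mulg1 mulVg => <-.
  by rewrite invMg invgK !mulgA mulVg mul1g mulgVK.
- have [[y eE]|//] := orbitP e; exists y => // sy1.
  by apply: te; rewrite eE tE sy1 mulg1 mulVg.
Qed.

(* The transducer built from [t] acts as the identity along a path as long as the
   path crosses no edge at a state where [t] is nontrivial; residual finiteness
   keeps [F] away from all translates of the two exchanged edges. *)
Lemma base_swap (F : seq (vertex N)) :
    bvertex 1 i \in F ->
    (forall z, z \in F -> exists p, [/\ path (@adj N) (bvertex 1 i) p,
       last (bvertex 1 i) p = z & {subset p <= F}]) ->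
    bvertex (vemb a) (nbr i) \notin F -> bvertex (vemb b) (nbr i) \notin F ->
  exists2 c : tree_aut N, C c &
    [/\ c (bvertex (vemb a) (nbr i)) = bvertex (vemb b) (nbr i),
        c (bvertex (vemb b) (nbr i)) = bvertex (vemb a) (nbr i) &
        forall z, z \in F -> c z = z].
Proof.
move=> iF Fconn aF bF.
pose rep (z : vertex N) := projT1 (cid (bvertexE z)).
have repE z : z = bvertex (rep z) (level z) := projT2 (cid (bvertexE z)).
(* When g represents a vertex of F and d is a or b, the element g d^-1 has to be told apart from
   1. *)
pose s := [seq zk.1 * (vemb d)^-1 |
  zk <- [seq (rep z * vemb k, z) | z <- F, k <- enum (vgrp N (nbr i))], d <- [:: a; b]].
have [M [t [fin sep [tV tA tE tN]]]] := periodic_twist s.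
have [M' [inj runE] [tt [emitE tti ttE]]] := twist_family tV tA.
have [|c Cc cE] := transducer_aut (M := M') (e := 1) inj.
  by apply: sub_finite_set fin => _ [g _ <-]; exists g.
(* If [t] were nontrivial at the state of g, separation would give g = y for some y in the coset of
   a or b, and the vertex of g would be an exchanged one. *)
have farF g : bvertex g (nbr i) \in F -> t (run M 1 g) = 1.
  move=> gF; apply/eqP/negP => /negP/eqP/tN[y gy /left_swap_neq1[d dab [k dk]]].
  have yE : vemb y = vemb d * vemb k by rewrite -dk -vembM mulKVg.
  have [k' gE] : exists k', g = rep (bvertex g (nbr i)) * @vemb N (nbr i) k'.
    exact/bvertex_eq/esym/(repE (bvertex g (nbr i))).
  have g1 : g * (vemb y)^-1 = 1.
    apply: sep; last by rewrite runM gy -runM mulgV run1.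
    apply/allpairsP; exists ((rep (bvertex g (nbr i)) * vemb (k' * k^-1), bvertex g (nbr i)), d).
    split=> /=.
    - apply/allpairsP; exists (bvertex g (nbr i), k' * k^-1).
      by split=> //=; rewrite mem_enum.
    - by rewrite !inE; case: dab => ->; rewrite eqxx ?orbT.
    - by rewrite vembM vembV mulgA -gE yE invMg mulgA.
  have gdE : bvertex g (nbr i) = bvertex (vemb d) (nbr i).
    by apply/esym/bvertex_eq; exists k; rewrite -yE; apply: (mulIg (vemb y)^-1); rewrite g1 mulgV.
  by move: gF; rewrite gdE; case: dab => ->; apply/negP.
(* Along untwisted edges the output telescopes to [T^-1 * g] up to the vertex group; left
   multiplication by [T] restores g. *)
pose T := vemb (t 1).
have fixP g j : bvertex g j \in F -> out M' 1 g = T^-1 * g * vemb (tt j (run M 1 g)) ->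
  forall p, path (@adj N) (bvertex g j) p -> {subset p <= F} ->
  (aut_of T * c) (last (bvertex g j) p) = last (bvertex g j) p.
  move=> gF gE p; elim: p g j gF gE => [|z p IH] g j gF gE /=.
    by rewrite cE gE vact_bvertex !mulgA mulgV mul1g bvertexM.
  move=> /andP[gz zp] pF.
  have zF : z \in F by apply: pF; rewrite inE eqxx.
  have pF' : {subset p <= F} by move=> y yp; apply: pF; rewrite inE yp orbT.
  (* An edge of index [i.-1] has an endpoint on level [nbr i], so [farF] makes [t] trivial there;
     edges of other indices are never twisted. *)
  have crossing h k : bvertex h k \in F -> bvertex h k.+1 \in F ->
      vemb (tt k (run M 1 h)) = vemb (tt k.+1 (run M 1 h)).
    move=> hk hk1; apply: ttE; case: (k =P i.-1) => [kE|]; last by right.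
    left; apply: farF; rewrite kE in hk hk1.
    by case: (i) hk hk1.
  have key h k : bvertex h k = bvertex g j ->
      out M' 1 h = T^-1 * h * vemb (tt k (run M 1 h)).
    move=> hE; have kj : k = j by case: hE.
    rewrite kj in hE *; have /bvertex_eq[x ->] := esym hE.
    rewrite outM gE out_vemb emitE /twisted !runE vembM vembM vembV runM run_vemb.
    by rewrite !mulgA mulgK.
  move: gz zF zp => /adjP[h [k [[gh ->]|[-> gh]]]] zF zp;
    rewrite gh in gF; apply: IH => //; rewrite (key _ _ (esym gh)).
    by rewrite crossing.
  by rewrite -crossing.
have cF z : z \in F -> (aut_of T * c) z = z.
  move=> /Fconn[p [vp <- pF]]; apply: fixP => //.
  by rewrite out1 run1 mulg1 tti mulVg.
have cd d d' : left_swap d = d' * d^-1 ->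
    (aut_of T * c) (bvertex (vemb d) (nbr i)) = bvertex (vemb d') (nbr i).
  move=> dE; rewrite autM cE out_vemb emitE /twisted !tti -run_vemb tE dE /=.
  by rewrite vact_bvertex -vembM !mulgA mulgV mul1g mulgV mul1g mulgVK.
exists (aut_of T * c); first by apply: commM => //; exact: comm_aut_of.
by split=> //; apply: cd; [exact: left_swap_l | exact: left_swap_r].
Qed.

End LeftSwap.
End Swaps.

(** * Density *)

Section Density.
Variable N : nagao_ray.
Hypothesis hsplit : directly_split N.
Hypothesis hN : nagao_type N.
Local Notation C := (commensurator (nagao_lattice N)).
Local Notation V := (vertex N).
Implicit Types (v w u x y z : V) (c : tree_aut N) (F : seq V).

Lemma autK c v : c^-1 (c v) = v.
Proof. by rewrite -autM mulVg. Qed.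

Lemma autVK c v : c (c^-1 v) = v.
Proof. by rewrite -autM mulgV. Qed.

Lemma aut_inj c : injective c.
Proof. exact: can_inj (autK c). Qed.

Lemma aut_path c v p : path (@adj N) (c v) (map c p) = path (@adj N) v p.
Proof. by rewrite path_map; apply: eq_path => x y /=; rewrite aut_adj. Qed.

(* A path from v avoiding u and u' reaches exactly the vertices outside the two
   branches at u and u'; in this form no property of trees is needed. *)
Definition swappable v u u' : Prop := forall F,
  (forall z, z \in F -> exists p,
     [/\ path (@adj N) v p, last v p = z, u \notin p & u' \notin p]) ->
  exists2 c, C c & [/\ c v = v, c u = u', c u' = u & forall z, z \in F -> c z = z].

Lemma swappable_sym v u u' : swappable v u u' -> swappable v u' u.
Proof.
move=> sw F FP; have [|c Cc [cv cu cu' cF]] := sw F; last by exists c.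
by move=> z /FP[p [p1 p2 p3 p4]]; exists p.
Qed.

Lemma swappable_conj c v u u' : C c -> swappable v u u' -> swappable (c v) (c u) (c u').
Proof.
move=> Cc sw F FP; have [|d Cd [dv du du' dF]] := sw [seq c^-1 z | z <- F].
  move=> _ /mapP[z /FP[p [vp <- up u'p]] ->]; exists [seq c^-1 y | y <- p].
  have qE : map c [seq c^-1 y | y <- p] = p.
    by rewrite -map_comp map_id_in // => y _ /=; rewrite autVK.
  have mem y : (y \in [seq c^-1 y | y <- p]) = (c y \in p).
    by rewrite -[in RHS]qE mem_map //; exact: aut_inj.
  rewrite -(aut_path c) qE !mem; split=> //.
  by apply: (@aut_inj c); rewrite -last_map qE autVK.
exists (c * d * c^-1); first exact: commM (commM Cc Cd) (commV Cc).
rewrite !autM !autK dv du du'; split=> // z zF.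
by rewrite !autM dF ?autVK // map_f.
Qed.

(** Conjugate an exchange of u' and u'' by an exchange of u and u' that fixes u''; the set F is
    moved along. *)
Lemma swappable_trans v u u' u'' : adj v u'' -> u'' != u -> u'' != u' ->
  swappable v u u' -> swappable v u' u'' -> swappable v u u''.
Proof.
move=> vu'' uu'' u'u'' sw1 sw2 F FP.
have [|c Cc [cv cu cu' cF]] := sw1 [:: u''].
  move=> z; rewrite inE => /eqP ->; exists [:: u''].
  by rewrite /= vu'' !inE eq_sym uu'' eq_sym u'u''.
have cu'' : c u'' = u'' by apply: cF; rewrite inE.
have [|d Cd [dv du' du'' dF]] := sw2 [seq c z | z <- F].
  move=> _ /mapP[z /FP[p [vp <- up u''p]] ->]; exists (map c p).
  rewrite -{1 2}cv aut_path last_map; split=> //.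
    by rewrite -cu mem_map //; exact: aut_inj.
  by rewrite -cu'' mem_map //; exact: aut_inj.
exists (c^-1 * d * c); first exact: commM (commM (commV Cc) Cd) Cc.
rewrite !autM cv dv cu du' cu'' du''.
split; first by rewrite -{1}cv autK.
- by rewrite -{1}cu'' autK.
- by rewrite -{1}cu autK.
- by move=> z zF; rewrite !autM dF ?autK // map_f.
Qed.

Lemma adj_nbr g i u : adj (bvertex g i) u -> level u = nbr i ->
  exists a : vgrp N i, u = bvertex (g * vemb a) (nbr i).
Proof.
move=> /adjP[h [k [[gh ->]|[-> gh]]]] /=.
  have ik : i = k by case: gh.
  rewrite -ik in gh *; case: i gh {ik} => [|i] gh /=; last first.
    by move=> /eqP; rewrite eqn_leq ltnNge leqnSn.
  by have /bvertex_eq[a ->] := gh; exists a.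
have ik : i = k.+1 by case: gh.
by rewrite ik in gh *; have /bvertex_eq[a ->] := gh; exists a.
Qed.

Lemma base_swappable i (a b : vgrp N i) :
  bvertex (vemb a) (nbr i) <> bvertex (vemb b) (nbr i) ->
  swappable (bvertex 1 i) (bvertex (vemb a) (nbr i)) (bvertex (vemb b) (nbr i)).
Proof.
move=> ab F FP; set v := bvertex 1 i; set u := bvertex _ _; set u' := bvertex _ _.
have /choice[P PP] : forall z, exists p, z \in F ->
    [/\ path (@adj N) v p, last v p = z, u \notin p & u' \notin p].
  move=> z; case: (boolP (z \in F)) => [/FP[p ?]|_]; last by exists [::].
  by exists p.
(* The paths to F are added so that every vertex is reached from v inside the set; they avoid u and
   u'. *)
pose F' := v :: flatten [seq P z | z <- F].
have inF' w : w \in F' -> w = v \/ exists2 z, z \in F & w \in P z.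
  by rewrite inE => /predU1P[|/flatten_mapP]; [left|right].
have ui : forall d : vgrp N i, bvertex (vemb d) (nbr i) != v.
  by move=> d; apply/eqP => -[] E _; move: E; case: (i) => // k /eqP; rewrite eqn_leq ltnn ?andbF.
have avoid w : w != v -> (forall z, z \in F -> w \notin P z) -> w \notin F'.
  move=> wv wP; apply/negP => /inF'[wE|[z zF wz]]; first by rewrite wE eqxx in wv.
  by have := wP z zF; rewrite wz.
have [|||||c Cc [cu cu' cF]] := @base_swap N hsplit i a b _ F'.
- by rewrite edge_elt_bvertex.
- by rewrite inE eqxx.
- move=> w wF; have [->|[z zF wz]] := inF' w wF; first by exists [::].
  have [vp _ _ _] := PP z zF.
  have PF y : y \in P z -> y \in F'.
    by move=> yz; rewrite inE; apply/orP; right; apply/flatten_mapP; exists z.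
  case: (path.splitP wz) vp PF => p1 p2 vp PF; exists (rcons p1 w).
  move: vp; rewrite cat_path last_rcons => /andP[-> _]; split=> // y yp.
  by apply: PF; rewrite mem_cat yp.
- by apply: avoid => // z /PP[].
- by apply: avoid => // z /PP[].
exists c => //; split=> //; first by apply: cF; rewrite inE eqxx.
move=> z zF; apply: cF; have [_ <- _ _] := PP z zF.
have := mem_last v (P z); rewrite !inE => /orP[->//|lz].
by apply/orP; right; apply/flatten_mapP; exists z; last by [].
Qed.

(** Upper neighbours being unique at positive levels, u and u' lie on level [nbr (level v)]; an
    element of G then moves v to the ray. *)
Lemma same_level_swappable v u u' : adj v u -> adj v u' -> level u = level u' ->
  u != u' -> swappable v u u'.
Proof.
move=> vu vu' uu' neq.
have lu : level u = nbr (level v).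
  have := adj_level vu; case E : (level v) => [|i] [] //=; last by case.
  move=> lu; case/eqP: neq; apply: (up_neighbour_unique _ vu vu'); rewrite ?E //.
  by rewrite -uu'.
have [g vE] := bvertexE v; move: (level v) lu vE => i lu vE.
rewrite vE in vu vu' *.
have [a uE] := adj_nbr vu lu; have [b u'E] := adj_nbr vu' (etrans (esym uu') lu).
rewrite uE u'E in neq *.
rewrite -[X in swappable (bvertex X i)]mulg1 -!vact_bvertex.
apply: (@swappable_conj (aut_of g)); first exact: comm_aut_of.
apply: base_swappable => ab; case/eqP: neq.
by rewrite -!vact_bvertex ab.
Qed.

(** * Vertices at which all pairs of neighbours can be exchanged *)

Definition full v : Prop := forall u u', adj v u -> adj v u' -> u != u' -> swappable v u u'.

Lemma full_conj c v : C c -> full v -> full (c v).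
Proof.
move=> Cc fv u u' vu vu' uu'; rewrite -(autVK c u) -(autVK c u').
apply: (swappable_conj Cc); apply: fv.
- by rewrite -(aut_adj c) autVK.
- by rewrite -(aut_adj c) autVK.
- by rewrite (can_eq (autVK c)).
Qed.

Lemma full_level0 v : level v = 0%N -> full v.
Proof.
move=> v0 u u' vu vu'; apply: same_level_swappable => //.
by have := adj_level vu; have := adj_level vu'; rewrite v0 => -[->|//] [->|].
Qed.

Lemma full_same_level v w : full v -> level w = level v -> full w.
Proof.
move=> fv lw; have [g vE] := bvertexE v; have [h wE] := bvertexE w.
have -> : w = aut_of (h * g^-1) v.
  by rewrite wE vE /= vact_bvertex mulgVK lw.
by apply: full_conj => //; exact: comm_aut_of.
Qed.

Lemma index_gt1 (gT : finGroupType) (A : {set gT}) : 1 < #|[set: gT]%SET : A| ->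
  exists a, a \notin A.
Proof.
move=> A1; apply/existsP; rewrite -negb_forall; apply: contraTN A1 => /forallP AT.
have -> : A = [set: gT]%SET by apply/setP => a; rewrite AT inE.
by rewrite indexgg.
Qed.

Lemma non_edge_elt i : 0 < i -> exists a : vgrp N i, ~ edge_elt a.
Proof.
case: i => [//|[|i]] _; have := hN; rewrite /nagao_type.
  move=> /(_ 1%N) /index_gt1[x xh]; exists x => -[y xy].
  have [h _ xE] := vemb_meet hsplit (isT : 0 < 1) (esym xy).
  by case/negP: xh; rewrite xE inc_id // imset_f ?inE.
move=> /(_ i.+2) /index_gt1[x xh]; exists x => -[y xy].
case/negP: xh; rewrite -(vemb_edge y) // in xy.
by rewrite (vemb_inj hsplit xy) imset_f ?inE.
Qed.

Lemma another_lower_neighbour v x : 0 < level v ->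
  exists z, [/\ adj v z, level v = (level z).+1 & z != x].
Proof.
have [g vE] := bvertexE v; rewrite {}vE /=.
case: (level v) => // i _; have [b nb] := @non_edge_elt i.+1 isT.
have adjg h : adj (bvertex h i.+1) (bvertex h i) by apply/adj_sym/adjS.
have [<-|gx] := eqVneq (bvertex g i) x; last by exists (bvertex g i); split.
exists (bvertex (g * vemb b) i); split=> //.
  by rewrite -(@bvertexM _ g i.+1 b).
apply/eqP => /esym/bvertex_eq[y /mulgI by_]; by apply: nb; exists y.
Qed.

(** Neighbours of c v other than c u are images of lower neighbours of v, so conjugation by c
    exchanges them. As c u is not above c v, it can be exchanged with the other lower neighbours of
    c v. *)
Lemma full_of_moved_up c v u : C c -> 0 < level v -> 0 < level (c v) -> adj v u ->
  level u = (level v).+1 -> level (c u) <> (level (c v)).+1 -> full (c v).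
Proof.
move=> Cc v0 w0 vu lu; set w := c v; set p := c u => lp.
have wp : adj w p by rewrite aut_adj.
have low x : adj w x -> level x <> (level w).+1 -> level w = (level x).+1.
  by move=> /adj_level[].
have sw_low x y : adj w x -> adj w y -> level x <> (level w).+1 ->
    level y <> (level w).+1 -> x != y -> swappable w x y.
  move=> wx wy /(low _ wx) lx /(low _ wy) ly; apply: same_level_swappable => //.
  by apply: succn_inj; rewrite -lx.
have sw_p x y : adj w x -> adj w y -> x != p -> y != p -> x != y -> swappable w x y.
  have lowv z : adj w z -> z != p -> level v = (level (c^-1 z)).+1.
    move=> wz zp; have vz : adj v (c^-1 z) by rewrite -(aut_adj c) autVK.
    have [lz|//] := adj_level vz; case/eqP: zp.
    by rewrite -[z](autVK c) -(up_neighbour_unique v0 vu vz).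
  move=> wx wy xp yp xy; rewrite -(autVK c x) -(autVK c y).
  apply: (swappable_conj Cc); apply: same_level_swappable.
  - by rewrite -(aut_adj c) autVK.
  - by rewrite -(aut_adj c) autVK.
  - by apply: succn_inj; rewrite -!lowv.
  - by rewrite (can_eq (autVK c)).
have sw y : adj w y -> y != p -> swappable w p y.
  move=> wy yp; have [ly|ly] := pselect (level y = (level w).+1); last first.
    by apply: sw_low => //; rewrite eq_sym.
  (* Only p and the upper neighbour y remain; a second lower neighbour z, given by the indices being
     at least 2, links them. *)
  have [z [wz lz zp]] := another_lower_neighbour p w0.
  have lz' : level z <> (level w).+1.
    by rewrite lz; apply/eqP; rewrite ltn_eqF // leqW.
  have yz : y != z by apply/eqP => yz; apply: lz'; rewrite -yz.
  apply: (@swappable_trans _ _ z) => //.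
    by apply: sw_low => //; rewrite eq_sym.
  by apply: sw_p => //; rewrite eq_sym.
move=> x y wx wy xy; have [E|xp] := eqVneq x p.
  by rewrite E; apply: sw => //; rewrite -E eq_sym.
have [E|yp] := eqVneq y p; first by rewrite E; exact/swappable_sym/sw.
exact: sw_p.
Qed.

(** Suppose only vertices of level 0 are full. Fullness is invariant under c, so c preserves level
    0; inductively, an upper neighbour not carried upwards would create a full vertex of positive
    level. *)
Lemma full_positive_level c : C c -> ~ level_preserving N c ->
  exists2 v, 0 < level v & full v.
Proof.
move=> Cc; apply: contra_notP => nofull.
have full0 v : full v -> level v = 0%N.
  by move=> fv; apply/eqP/negPn/negP; rewrite -lt0n => v0; apply: nofull; exists v.
have c0 v : level (c v) = 0%N -> level v = 0%N.
  move=> /full_level0 fcv; apply: full0; rewrite -(autK c v).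
  by apply: full_conj => //; exact: commV.
suff cn n v : level v = n -> level (c v) = n by move=> v; exact: cn.
elim: n v => [|n IH] v vn; first by apply/full0/(full_conj Cc)/full_level0.
have [g vE] := bvertexE v; pose w := bvertex g n.
have wv : adj w v by rewrite vE vn; exact: adjS.
have lcw : level (c w) = n by exact: IH.
have cwv : adj (c w) (c v) by rewrite aut_adj.
apply: contrapT => lcv; have [n0|n0] := posnP n.
  by have := adj_level cwv; rewrite lcw => -[//|]; rewrite n0.
have : full (c w) by apply: (full_of_moved_up Cc _ _ wv); rewrite ?lcw.
by move=> /full0; rewrite lcw => nE; rewrite nE in n0.
Qed.

(** Fullness of v gives c fixing v and exchanging its neighbours u above and w below. Then c carries
    w to u while v, which is above w, lies below u; this makes u full, and w is its image under
    c. *)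
Lemma full_neighbours j : (forall v, level v = j.+1 -> full v) ->
  (forall v, level v = j.+2 -> full v) /\ (forall v, level v = j -> full v).
Proof.
move=> fj; pose v := @bvertex N 1 j.+1; pose u := @bvertex N 1 j.+2; pose w := @bvertex N 1 j.
have vu : adj v u by exact: adjS.
have wv : adj w v by exact: adjS.
have uw : u != w by apply/eqP => -[] /eqP; rewrite eqn_leq ltnNge leqW ?andbF.
have [|c Cc [cv cu cw _]] := fj v erefl u w vu (adj_sym wv) uw [::]; first by [].
have fu : full u.
  have [j0|j0] := posnP j; first by rewrite -cw; exact/full_conj/full_level0.
  rewrite -cw; apply: (full_of_moved_up Cc (j0 : 0 < level w) _ wv) => //.
    by rewrite cw.
  by rewrite cw cv /=; apply/eqP; rewrite ltn_eqF // leqW.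
have fw : full w by rewrite -cu; exact: full_conj.
by split=> x lx; [apply: full_same_level fu _ | apply: full_same_level fw _].
Qed.

(** From the given positive level fullness descends to level 1, then climbs to all levels. *)
Lemma full_everywhere c : C c -> ~ level_preserving N c -> forall v, full v.
Proof.
move=> Cc nc v; have [w w0 fw] := full_positive_level Cc nc.
have fi x : level x = level w -> full x by exact: full_same_level.
move: (level w) w0 fi => i i0 fi {w fw c Cc nc}.
have f1 : forall x, level x = 1%N -> full x.
  case: i i0 fi => // i _; elim: i => // i IH fi; apply: IH.
  by have [] := full_neighbours fi.
suff fS n x : level x = n.+1 -> full x.
  by case E : (level v) => [|n]; [exact: full_level0 | exact: fS E].
by elim: n x => // n IH; have [] := full_neighbours IH.
Qed.

(** * Approximation of type-preserving automorphisms on finite sets *)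

Section Approximation.
Hypothesis allfull : forall v, full v.

(** Two steps are undone at a time by an exchange around the middle vertex. *)
Lemma comm_even_path v p : path (@adj N) v p -> ~~ odd (size p) ->
  exists2 c, C c & c (last v p) = v.
Proof.
have [n] := ubnP (size p); elim: n p v => // n IH [|y [|z p]] v //= pn.
  by exists (aut_of 1); [exact: comm_aut_of | exact: vact1].
move=> /and3P[vy yz zp]; rewrite negbK => p_even.
have [|c Cc cz] := IH p z _ zp p_even; first by rewrite ltnW // -ltnS.
have [vz|vz] := eqVneq v z; first by exists c; rewrite ?vz.
have [|d Cd [_ _ dz _]] := allfull (adj_sym vy) yz vz (F := [::]); first by [].
by exists (d * c); [exact: commM | rewrite autM cz].
Qed.

Definition connected_seq F : Prop := forall y z, y \in F -> z \in F -> exists p,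
  [/\ path (@adj N) y p, last y p = z & {subset p <= F}].

Lemma extend_path (f : tree_aut N) F c y p :
    connected_seq F -> C c -> (forall z, z \in F -> c z = f z) ->
    y \in F -> path (@adj N) y p ->
  exists F' c', [/\ connected_seq F', C c', forall z, z \in F' -> c' z = f z,
    {subset F <= F'} & {subset p <= F'}].
Proof.
elim: p F c y => [|u p IH] F c y Fcon Cc cf yF /=; first by exists F, c; split=> // z.
move=> /andP[yu up].
suff [F' [c' [Fcon' Cc' cf' FF' uF']]] : exists F' c', [/\ connected_seq F', C c',
    forall z, z \in F' -> c' z = f z, {subset F <= F'} & u \in F'].
  have [F2 [c2 [Fcon2 Cc2 cf2 FF2 pF2]]] := IH F' c' u Fcon' Cc' cf' uF' up.
  exists F2, c2; split=> // [z /FF' /FF2 //|z].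
  by rewrite inE => /predU1P[->|/pF2 //]; exact: FF2.
have [uF|uF] := boolP (u \in F); first by exists F, c; split.
(* As h fixes F, both u and h u are neighbours of y outside F. If they differ, an exchange at y
   carries u to h u and fixes F, whose paths from y avoid both. *)
pose h := c^-1 * f.
have hF z : z \in F -> h z = z by move=> zF; rewrite autM -cf // autK.
have huF : h u \notin F.
  by apply: contra uF => hu; rewrite -(aut_inj (hF _ hu)).
have [e Ce [eu eF]] : exists2 e, C e & e u = h u /\ forall z, z \in F -> e z = z.
  have [hu|hu] := eqVneq u (h u).
    by exists (aut_of 1); [exact: comm_aut_of | split=> [|z _]; rewrite /= vact1].
  have yhu : adj y (h u) by rewrite -{1}(hF y yF) aut_adj.
  have [|e Ce [_ eu _ eF]] := allfull yu yhu hu (F := F); last by exists e.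
  move=> z zF; have [q [yq qz qF]] := Fcon y z yF zF; exists q; split=> //.
    by apply: contra uF => /qF.
  by apply: contra huF => /qF.
exists (u :: F), (c * e); split; last by rewrite inE eqxx.
- have to_u z : z \in F -> exists p, [/\ path (@adj N) z p, last z p = u &
      {subset p <= u :: F}].
    move=> zF; have [q [zq qy qF]] := Fcon z y zF yF; exists (rcons q u).
    rewrite rcons_path last_rcons zq qy; split=> // x.
    by rewrite mem_rcons !inE => /predU1P[->|/qF ->]; rewrite ?eqxx ?orbT.
  move=> x z; rewrite !inE => /predU1P[->|xF] /predU1P[->|zF].
  + by exists [::].
  + have [q [yq qz qF]] := Fcon y z yF zF; exists (y :: q).
    rewrite /= (adj_sym yu) yq; split=> // a; rewrite !inE => /predU1P[->|/qF ->].
      by rewrite yF orbT.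
    by rewrite orbT.
  + exact: to_u.
  + have [q [xq qz qF]] := Fcon x z xF zF; exists q; split=> // a /qF aF.
    by rewrite inE aF orbT.
- exact: commM.
- move=> z; rewrite inE autM => /predU1P[->|zF]; last by rewrite eF // cf.
  by rewrite eu /h autM autVK.
- by move=> z zF; rewrite inE zF orbT.
Qed.

Lemma type_preserving_approx (f : tree_aut N) F : type_preserving N f ->
  exists2 c, C c & forall z, z \in F -> c z = f z.
Proof.
move=> ft; pose v := @bvertex N 1 0.
(* The base vertex moves by an even distance, which gives a first approximation at that vertex
   alone. *)
have [n [[p [pv pl pn]] _] n_even] := ft v.
have [|c0 Cc0 c0v] := comm_even_path pv; first by rewrite pn.
rewrite pl in c0v.
suff [F' [c [_ Cc cf _ FF']]] : exists F' c, [/\ connected_seq F', C c,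
    forall z, z \in F' -> c z = f z, v \in F' & {subset F <= F'}].
  by exists c => // z /FF'; exact: cf.
elim: F => [|x F [F' [c [Fcon Cc cf vF FF']]]].
  exists [:: v], c0; split=> // [y z|z|]; rewrite ?inE //.
    by move=> -> ->; exists [::].
  by move=> ->.
have [q [vq qx]] := tree_connected v x.
have [F2 [c2 [Fcon2 Cc2 cf2 FF2 qF2]]] := extend_path Fcon Cc cf vF vq.
exists F2, c2; split=> //; first exact: FF2.
move=> z; rewrite inE => /predU1P[->|/FF' /FF2 //].
have := mem_last v q; rewrite qx inE => /predU1P[->|/qF2 //]; exact: FF2.
Qed.

End Approximation.
End Density.

Theorem theorem5 (N : nagao_ray)
  (hN : nagao_type N) (hsplit : directly_split N) (hreg : biregular N) :
  ~ (commensurator (nagao_lattice N) `<=` level_preserving N) ->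
  type_preserving N `<=` closure (commensurator (nagao_lattice N)).
Proof.
move=> /existsNP[c0 /not_implyP[Cc0 nc0]] f ft B [F [Ffin _ _] FB].
have [s Fs] := (finite_seqP F).1 Ffin.
have [c Cc cf] := type_preserving_approx (full_everywhere hsplit hN Cc0 nc0) s ft.
(* Since c agrees with f on F, [f^-1 * c] fixes F pointwise and c lies in the basic neighbourhood of
   f. *)
exists c; split=> //; apply: FB; exists (f^-1 * c); last by rewrite mulVKg.
move=> v Fv; rewrite autM cf ?autK //.
by rewrite Fs in Fv.
Qed.
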